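(* Let $\mathcal{L}$ be a hyperatomic commutative subspace lattice on a separable Hilbert space $\mathcal{H}$. Suppose that $\mathcal{A}\subseteq\operatorname{Alg}\mathcal{L}$ is a norm closed operator algebra whose closure in the weak operator topology is $\operatorname{Alg}\mathcal{L}$. Assume that $E\mathcal{A}F\subseteq\mathcal{A}$ for all atoms $E$ and $F$ of $\mathcal{L}$ and that $E\mathcal{A}E$ is a $C^*$-algebra for each atom $E$ of $\mathcal{L}$. Then $\operatorname{Man}(\mathcal{A})=\operatorname{Lat}(\mathcal{A})=\mathcal{L}$, every element of $\operatorname{Man}(\mathcal{A})$ is singly generated, and $\mathcal{A}$ is $\operatorname{Alg}\mathcal{L}$-transitive.
   Context: All Hilbert spaces are separable. A commutative subspace lattice (CSL) $\mathcal{L}$ on $\mathcal{H}$ is a strongly closed lattice of mutually commuting orthogonal projections containing $0$ and $I$; projections are identified with their (closed) ranges. $\operatorname{Alg}\mathcal{L}$ is the algebra of all $T\in\mathcal{B}(\mathcal{H})$ with $T(P\mathcal{H})\subseteq P\mathcal{H}$ for all $P\in\mathcal{L}$. An atom of $\mathcal{L}$ is a minimal non-zero interval: a non-zero projection of the form $E-F$ with $E,F\in\mathcal{L}$, $F\le E$, that contains no strictly smaller non-zero projection of this form. For atoms $A_1,\dots,A_k$, $E(A_1,\dots,A_k)$ denotes the smallest projection in $\mathcal{L}$ containing $A_1,\dots,A_k$. A projection $P\in\mathcal{L}$ is hyperatomic if $P=E(A_1,\dots,A_k)$ for some finite collection of atoms of $\mathcal{L}$; $\mathcal{L}$ is hyperatomic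 if every non-zero projection in $\mathcal{L}$ is hyperatomic. For an operator algebra $\mathcal{A}\subseteq\mathcal{B}(\mathcal{H})$, $\operatorname{Man}\mathcal{A}$ is the set of all linear subspaces (not necessarily closed) of $\mathcal{H}$ invariant under $\mathcal{A}$, and $\operatorname{Lat}\mathcal{A}$ is the set of all closed subspaces of $\mathcal{H}$ invariant under $\mathcal{A}$. For $x\in\mathcal{H}$, $\{\mathcal{A}x\}=\{Ax: A\in\mathcal{A}\}$. An element $\mathcal{M}\in\operatorname{Man}\mathcal{A}$ is singly generated if $\mathcal{M}=\{\mathcal{A}x\}$ for some $x\in\mathcal{H}$. For operator algebras $\mathcal{B},\mathcal{C}\subseteq\mathcal{B}(\mathcal{H})$, $\mathcal{B}$ is $\mathcal{C}$-transitive if $\{\mathcal{B}x\}=\{\mathcal{C}x\}$ for every $x\in\mathcal{H}$. *)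

(* Defs.v *)
From HB Require Import structures.
From mathcomp Require Import all_boot all_order all_algebra.
From mathcomp Require Import sesquilinear complex.
From mathcomp Require Import all_classical all_reals topology normedtype.

Set Implicit Arguments.
Unset Strict Implicit.
Unset Printing Implicit Defensive.

Import Order.TTheory GRing.Theory Num.Theory.
Import numFieldTopology.Exports numFieldNormedType.Exports.

Local Open Scope classical_set_scope.
Local Open Scope ring_scope.
Local Open Scope complex_scope.

Definition separable_space (T : topologicalType) : Prop :=
  exists2 D : set T, countable D & dense D.

(* A Hilbert space is a complete normed space over [R[i]] together with an
   inner product, linear in its first argument and inducing the norm. *)
Definition induces_norm (R : realType) (H : completeNormedModType R[i])
    (dot : {dot H for (@Num.conj R[i])}) : Prop :=
  forall x : H, `|x| ^+ 2 = dot x x.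

Section operators.
Context {R : realType} {H : completeNormedModType R[i]}.
Implicit Types (S T : H -> H) (A B : set (H -> H)).

Definition opbound T (M : R) : Prop :=
  0 <= M /\ forall x, `|T x| <= M%:C * `|x|.

(* Operators are plain maps, with the pointwise vector space structure
   of [H -> H]. *)
Definition bounded_operators : set (H -> H) :=
  [set T | linear T /\ exists M, opbound T M].

Definition opnorm T : R := inf [set M | opbound T M].

Definition norm_closed A : Prop :=
  forall T, bounded_operators T ->
    (forall e : R, 0 < e -> exists2 S, A S & opnorm (T - S) < e) -> A T.

(* The strong operator topology is the trace of the topology of pointwise
   convergence on the bounded operators. *)
Definition sot_closed A : Prop :=
  closure (A : set {ptws H -> H}) `&` bounded_operators `<=` A.

(* Not assumed to be unital. *)
Definition operator_algebra A : Prop :=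
  [/\ A `<=` bounded_operators,
      submod_closed (mem A) &
      forall S T, A S -> A T -> A (S \o T)].

Definition orbit A (x : H) : set H := [set T x | T in A].

Definition transitive_over B A : Prop := forall x, orbit B x = orbit A x.

Definition man A : set (set H) :=
  [set M : set H | submod_closed (mem M) /\ forall T, A T -> T @` M `<=` M].

Definition lat A : set (set H) := [set M | man A M /\ closed M].

Definition singly_generated A (M : set H) : Prop :=
  exists x, M = orbit A x.

Definition compression (E : H -> H) A (F : H -> H) : set (H -> H) :=
  [set E \o T \o F | T in A].

End operators.

Section inner_product.
Context {R : realType} {H : completeNormedModType R[i]}.
Variable dot : {dot H for (@Num.conj R[i])}.
Implicit Types (S T : H -> H) (A : set (H -> H)).

Definition matrix_coefficients T : {ptws (H * H)%type -> R[i]^o} :=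
  fun xy => dot (T xy.1) xy.2.

(* The weak operator topology is the trace on the bounded operators of the
   initial topology of the functionals T |-> dot (T x) y. *)
Definition wot_closure A : set (H -> H) :=
  closure (A : set (initial_topology matrix_coefficients))
    `&` bounded_operators.

Definition adjoint T S : Prop := forall x y, dot (T x) y = dot x (S y).

Definition cstar_algebra A : Prop :=
  [/\ operator_algebra A, norm_closed A &
      forall T, A T -> exists2 S, A S & adjoint T S].

Definition orthogonal_projection : set (H -> H) :=
  [set P | [/\ bounded_operators P, P \o P = P & adjoint P P]].

Record csl (L : set (H -> H)) : Prop := Csl {
  csl_proj : L `<=` orthogonal_projection;
  csl_comm : forall P Q, L P -> L Q -> P \o Q = Q \o P;
  csl_bot : L 0;
  csl_top : L id;
  csl_meet : forall P Q, L P -> L Q ->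
    exists2 N, L N & range N = range P `&` range Q;
  csl_join : forall P Q, L P -> L Q ->
    exists2 N, L N &
      range N = closure [set x + y | x in range P & y in range Q];
  csl_closed : sot_closed L
}.

End inner_product.

Section lattices.
Context {R : realType} {H : completeNormedModType R[i]}.
Variable L : set (H -> H).

Definition proj_le (P Q : H -> H) : Prop := range P `<=` range Q.

Definition alg : set (H -> H) :=
  [set T | bounded_operators T /\
           forall P, L P -> T @` range P `<=` range P].

Definition nonzero_interval (A : H -> H) : Prop :=
  A <> 0 /\ exists E F, [/\ L E, L F, proj_le F E & A = E - F].

Definition atom (A : H -> H) : Prop :=
  nonzero_interval A /\
  forall B, nonzero_interval B -> proj_le B A -> B = A.

(* [P] is the projection written E(A_1, ..., A_k). *)
Definition smallest_containing (k : nat) (A : 'I_k -> (H -> H))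
    (P : H -> H) : Prop :=
  [/\ L P, forall i, proj_le (A i) P &
      forall Q, L Q -> (forall i, proj_le (A i) Q) -> proj_le P Q].

Definition hyperatomic_projection (P : H -> H) : Prop :=
  exists (k : nat) (A : 'I_k -> (H -> H)),
    (forall i, atom (A i)) /\ smallest_containing A P.

Definition hyperatomic : Prop :=
  forall P, L P -> P <> 0 -> hyperatomic_projection P.

Definition ranges : set (set H) := [set range P | P in L].

End lattices.

(* Main.v *)
Require Import Defs.
From mathcomp Require Import all_boot all_order all_algebra.
From mathcomp Require Import sesquilinear complex.
From mathcomp Require Import all_classical all_reals topology normedtype.
From mathcomp Require Import sequences ring lra.

Set Implicit Arguments.
Unset Strict Implicit.
Unset Printing Implicit Defensive.

Import Order.TTheory GRing.Theory Num.Theory.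
Import numFieldTopology.Exports numFieldNormedType.Exports.

Local Open Scope classical_set_scope.
Local Open Scope ring_scope.
Local Open Scope complex_scope.

(** The lattice L is recovered from the orbits of A: for any set S of vectors,
   let P be the smallest projection of L with S in its range. Then every linear
   manifold containing the orbits A x, x in S, contains the whole range of P
   (smallest_over_in_orbits). Taking S to be the vectors of an invariant
   manifold shows that this manifold is the range of P; taking S = {x} shows
   that A x is the range of P, as is (Alg L) x; and a vector with a nonzero
   component in each of finitely many atoms generating P has the range of P as
   its orbit.

   On the lattice side, P is the hull of finitely many atoms, and minimality of
   P over S lets one discard the atoms vanishing on S
   (discard_vanishing_atoms). So it is enough to show that if an atom E has
   E x <> 0, then A x contains the range of the hull U of E (hull_in_orbit). The
   same discarding argument, with S = {z}, shows that only z = 0 is killed by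
   all atoms, so that finite sums of atoms approximate the identity strongly
   (atoms_approx).

   On the operator side, E A E is a C*-algebra that is weakly dense in all
   operators on the range of E, hence acts transitively there by Kadison's
   theorem, with control of the norms (kadison). If G is an atom below U, then
   G A E is nonzero by weak density; sandwiching one of its elements between
   operators of G A G and E A E sends E x to any vector of the range of G, with
   a bound independent of G (dominated_transitive). Ranges of distinct atoms
   being orthogonal, these operators can be added over finitely many atoms
   without loss in the norm (finite_sum_in_orbit), so each y in the range of U
   is matched up to |y| / 2 by T x with |T| <= C |y|. Successive approximation
   in the norm closed algebra A then solves T x = y exactly
   (solve_by_halving).

   Kadison's theorem is itself proved by successive approximation. For x and y
   of equal norm, weak density and a bipolar argument in H x H give T in the
   corner with T x close to y and T* y close to x (bipolar_pair). No bound on T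
   is available, but 2 T (1 + T* T)^-1 is a contraction which still sends x close
   to y (kaplansky_contraction), and a Neumann series places it in the corner. *)

(** * The real norm and the real inner product *)

(** The norm of H and its inner product take values in R[i], which is only
   partially ordered; all estimates are made on their real parts. *)

Section RealNorm.
Context {R : realType} {H : completeNormedModType R[i]}.
Implicit Types (x y z : H) (c : R) (S T : H -> H).

Definition nrm x : R := complex.Re `|x|.

Lemma nrmE x : `|x| = (nrm x)%:C.
Proof.
have := normr_ge0 x; rewrite /nrm; case: `|x| => a b.
by rewrite lecE /= => /andP[/eqP-> _].
Qed.

Lemma nrm_ge0 x : 0 <= nrm x.
Proof. by rewrite -ler0c -nrmE. Qed.

Lemma nrm0 : nrm 0 = 0.
Proof. by rewrite /nrm normr0. Qed.

Lemma nrm_eq0 x : nrm x = 0 -> x = 0.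
Proof. by move=> x0; apply/eqP; rewrite -normr_eq0 nrmE x0. Qed.

Lemma nrm_gt0 x : x <> 0 -> 0 < nrm x.
Proof.
by move=> x0; rewrite lt_def nrm_ge0 andbT; apply/eqP => /nrm_eq0.
Qed.

Lemma nrmD x y : nrm (x + y) <= nrm x + nrm y.
Proof. by rewrite -lecR rmorphD /= -!nrmE ler_normD. Qed.

Lemma nrmN x : nrm (- x) = nrm x.
Proof. by rewrite /nrm normrN. Qed.

Lemma nrmB x y : nrm (x - y) <= nrm x + nrm y.
Proof. by rewrite -(nrmN y) nrmD. Qed.

Lemma nrmBC x y : nrm (x - y) = nrm (y - x).
Proof. by rewrite /nrm distrC. Qed.

Lemma nrm_dist_le x y z : nrm (x - z) <= nrm (x - y) + nrm (y - z).
Proof. by rewrite (le_trans _ (nrmD _ _))// addrA subrK. Qed.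

Lemma nrmZ c x : nrm (c%:C *: x) = `|c| * nrm x.
Proof.
apply: (@complexI R); rewrite rmorphM /= -!nrmE normrZ normc_def /=.
by rewrite expr0n addr0 sqrtr_sqr.
Qed.

Lemma nrm_scaleC (a : R[i]) :
  exists2 r : R, 0 <= r & forall x, nrm (a *: x) = r * nrm x.
Proof.
exists (Num.sqrt (complex.Re a ^+ 2 + complex.Im a ^+ 2)).
  exact: sqrtr_ge0.
move=> x; apply: (@complexI R); rewrite rmorphM /= -!nrmE -normc_def.
exact: normrZ.
Qed.

Lemma nrm_small x : (forall e : R, 0 < e -> nrm x <= e) -> x = 0.
Proof.
move=> h; apply: contrapT => /nrm_gt0 x0.
have /h : 0 < nrm x / 2 by rewrite divr_gt0.
by rewrite leNgt => /negP; apply; rewrite ltr_pdivrMr// mulr2n mulrDr mulr1 ltrDl.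
Qed.

Lemma abs_small c : (forall e : R, 0 < e -> `|c| <= e) -> c = 0.
Proof.
move=> h; apply/eqP; rewrite -normr_eq0 eq_le normr_ge0 andbT.
by apply/ler_addgt0Pr => e e0; rewrite add0r h.
Qed.

Lemma opboundE T (M : R) :
  opbound T M <-> 0 <= M /\ forall x, nrm (T x) <= M * nrm x.
Proof.
split=> -[M0 TM]; split=> // x; have := TM x.
  by rewrite !nrmE -rmorphM lecR.
by rewrite !nrmE -rmorphM lecR.
Qed.

Lemma nrm_complete (u : nat -> H) :
  (forall e : R, 0 < e -> exists N, forall m n, (N <= m)%N -> (N <= n)%N ->
    nrm (u m - u n) <= e) ->
  exists l, forall e : R, 0 < e ->
    exists N, forall n, (N <= n)%N -> nrm (u n - l) <= e.
Proof.
move=> cu.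
have : cauchy (u @ \oo).
  apply/cauchy_ballP => e e0.
  have e0' : 0 < complex.Re e by move: e0; rewrite ltcE => /andP[].
  have eE : e = (complex.Re e)%:C by rewrite RRe_real ?gtr0_real.
  have /cu[N uN] : 0 < complex.Re e / 2 by rewrite divr_gt0.
  have FN : (u @ \oo) (u @` [set n | (N <= n)%N]).
    by exists N => // n /= Nn; exists n.
  exists (u @` [set n | (N <= n)%N], u @` [set n | (N <= n)%N]) => //=.
  move=> [a b] /= [[m Nm <-] [n Nn <-]].
  rewrite -ball_normE /= nrmE eE ltcR (le_lt_trans (uN _ _ Nm Nn))//.
  by rewrite ltr_pdivrMr// mulr2n mulrDr mulr1 ltrDl.
move=> /cauchy_cvg /cvg_ex[l /= ul]; exists l => e e0.
have /cvgr_dist_le/(_ e%:C) := ul; rewrite ltcR => /(_ e0)[N _ uN].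
by exists N => n /uN; rewrite nrmE lecR nrmBC.
Qed.

End RealNorm.

Section RealInner.
Context {R : realType} {H : completeNormedModType R[i]}.
Variable dot : {dot H for (@Num.conj R[i])}.
Hypothesis dot_norm : induces_norm dot.
Implicit Types (x y z : H) (c : R) (S T P Q : H -> H).

Definition rdot x y : R := complex.Re (dot x y).

Lemma dotC x y : dot x y = Num.conj (dot y x).
Proof. by rewrite [LHS]hermC expr0 mul1r. Qed.

Lemma rdotC x y : rdot x y = rdot y x.
Proof.
rewrite /rdot dotC.
by apply: (@complexI R); rewrite !complexRe Re_conj.
Qed.

Lemma rdotDl x y z : rdot (x + y) z = rdot x z + rdot y z.
Proof. by rewrite /rdot linearDl raddfD. Qed.

Lemma rdotNl x z : rdot (- x) z = - rdot x z.
Proof. by rewrite /rdot linearNl raddfN. Qed.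

Lemma rdotBl x y z : rdot (x - y) z = rdot x z - rdot y z.
Proof. by rewrite rdotDl rdotNl. Qed.

Lemma rdotZl c x z : rdot (c%:C *: x) z = c * rdot x z.
Proof. by rewrite /rdot linearZl_LR /=; case: (dot x z) => a b /=; ring. Qed.

Lemma rdotDr x y z : rdot z (x + y) = rdot z x + rdot z y.
Proof. by rewrite rdotC rdotDl !(rdotC _ z). Qed.

Lemma rdotNr x z : rdot z (- x) = - rdot z x.
Proof. by rewrite rdotC rdotNl (rdotC _ z). Qed.

Lemma rdotBr x y z : rdot z (x - y) = rdot z x - rdot z y.
Proof. by rewrite rdotDr rdotNr. Qed.

Lemma rdotZr c x z : rdot z (c%:C *: x) = c * rdot z x.
Proof. by rewrite rdotC rdotZl (rdotC _ z). Qed.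

Lemma rdot0l z : rdot 0 z = 0.
Proof. by rewrite /rdot linear0l. Qed.

Lemma rdot0r z : rdot z 0 = 0.
Proof. by rewrite rdotC rdot0l. Qed.

Definition rdotE := (rdotDl, rdotDr, rdotNl, rdotNr, rdotZl, rdotZr).

Lemma nrm_sqr x : nrm x ^+ 2 = rdot x x.
Proof. by rewrite /rdot -dot_norm nrmE -rmorphXn. Qed.

Lemma cauchy_schwarz x y : rdot x y <= nrm x * nrm y.
Proof.
have [->|/eqP y0] := eqVneq y 0; first by rewrite rdot0r nrm0 mulr0.
have yp := nrm_gt0 y0.
have := sqr_ge0 (nrm ((nrm y)%:C *: x - (nrm x)%:C *: y)).
rewrite nrm_sqr !rdotE -!nrm_sqr (rdotC y x).
have := nrm_ge0 x; rewrite le_eqVlt => /orP[/eqP xE|xp].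
  by move=> _; rewrite (nrm_eq0 (esym xE)) rdot0l nrm0 mul0r.
move: (nrm x) (nrm y) (rdot x y) xp yp => a b d a0 b0 h.
have h' : 0 <= 2 * (a * b) * (a * b - d) by nra.
by move: h'; rewrite pmulr_rge0 ?subr_ge0// !mulr_gt0.
Qed.

Lemma abs_cauchy_schwarz x y : `|rdot x y| <= nrm x * nrm y.
Proof.
rewrite ler_norml cauchy_schwarz andbT lerNl -rdotNl -(nrmN x).
exact: cauchy_schwarz.
Qed.

Lemma nrm_sqrD x y : nrm (x + y) ^+ 2 = nrm x ^+ 2 + 2 * rdot x y + nrm y ^+ 2.
Proof. by rewrite !nrm_sqr !rdotE (rdotC y x); ring. Qed.

Lemma nrm_sqrB x y : nrm (x - y) ^+ 2 = nrm x ^+ 2 - 2 * rdot x y + nrm y ^+ 2.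
Proof. by rewrite !nrm_sqr !rdotE (rdotC y x); ring. Qed.

Lemma adjoint_rdot S T x y : adjoint dot S T -> rdot (S x) y = rdot x (T y).
Proof. by move=> ST; rewrite /rdot ST. Qed.

Lemma adjoint_sym S T : adjoint dot S T -> adjoint dot T S.
Proof.
move=> ST x y.
by rewrite (dotC x) ST -dotC.
Qed.

End RealInner.

(** * Linear maps, bounds and limits *)

Section Linear.
Context {R : realType} {H : completeNormedModType R[i]}.
Implicit Types (x y z : H) (S T : H -> H).

Lemma linear_id : linear (id : H -> H).
Proof. by []. Qed.

Lemma linear_cst0 : linear (0 : H -> H).
Proof. by move=> a x y; rewrite /= scaler0 addr0. Qed.

Lemma linear_comp S T : linear S -> linear T -> linear (S \o T).
Proof. by move=> lS lT a x y; rewrite /= lT lS. Qed.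

Lemma linear_lincomb (a : R[i]) S T :
  linear S -> linear T -> linear (a *: S + T).
Proof.
move=> lS lT b x y.
have -> z : (a *: S + T) z = a *: S z + T z by [].
by rewrite lS lT !scalerDr !scalerA (mulrC a) -!addrA; congr +%R; rewrite addrCA.
Qed.

Lemma linear_add S T : linear S -> linear T -> linear (S + T).
Proof. by move=> lS lT; rewrite -[S]scale1r; exact: linear_lincomb. Qed.

Lemma linear_opp S : linear S -> linear (- S).
Proof.
move=> lS; rewrite -scaleN1r -[_ *: _]addr0.
by apply: linear_lincomb => //; exact: linear_cst0.
Qed.

Lemma linear_sub S T : linear S -> linear T -> linear (S - T).
Proof. by move=> lS lT; apply: linear_add => //; exact: linear_opp. Qed.

Lemma linD T x y : linear T -> T (x + y) = T x + T y.
Proof. by move=> lT; have := lT 1 x y; rewrite !scale1r. Qed.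

Lemma lin0 T : linear T -> T 0 = 0.
Proof.
move=> lT; have := linD 0 0 lT; rewrite addr0 => /eqP.
by rewrite -subr_eq subrr => /eqP.
Qed.

Lemma linZ T (a : R[i]) x : linear T -> T (a *: x) = a *: T x.
Proof. by move=> lT; have := lT a x 0; rewrite (lin0 lT) !addr0. Qed.

Lemma linN T x : linear T -> T (- x) = - T x.
Proof. by move=> lT; rewrite -scaleN1r (linZ _ _ lT) scaleN1r. Qed.

Lemma linB T x y : linear T -> T (x - y) = T x - T y.
Proof. by move=> lT; rewrite (linD _ _ lT) (linN _ lT). Qed.

Lemma opbound_comp S T (M N : R) :
  opbound S M -> opbound T N -> opbound (S \o T) (M * N).
Proof.
move=> /opboundE[M0 SM] /opboundE[N0 TN]; apply/opboundE.
split=> [|x]; first exact: mulr_ge0.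
by rewrite (le_trans (SM _))// -mulrA ler_wpM2l.
Qed.

Lemma opbound_add S T (M N : R) :
  opbound S M -> opbound T N -> opbound (S + T) (M + N).
Proof.
move=> /opboundE[M0 SM] /opboundE[N0 TN]; apply/opboundE.
split=> [|x]; first exact: addr_ge0.
by rewrite (le_trans (nrmD _ _))// mulrDl lerD.
Qed.

Lemma opbound_scale (c : R) T (M : R) :
  opbound T M -> opbound (c%:C *: T) (`|c| * M).
Proof.
move=> /opboundE[M0 TM]; apply/opboundE.
split=> [|x]; first exact: mulr_ge0.
by rewrite nrmZ -mulrA ler_wpM2l.
Qed.

Lemma opbound_opp T (M : R) : opbound T M -> opbound (- T) M.
Proof.
move=> /opboundE[M0 TM]; apply/opboundE; split=> // x.
by rewrite nrmN.
Qed.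

Lemma opbound_le T (M N : R) : opbound T M -> M <= N -> opbound T N.
Proof.
move=> /opboundE[M0 TM] MN; apply/opboundE; split=> [|x].
  exact: le_trans MN.
by rewrite (le_trans (TM x))// ler_wpM2r ?nrm_ge0.
Qed.

Lemma closure_nrmP (M : set H) x :
  closure M x <-> forall e : R, 0 < e -> exists2 y, M y & nrm (x - y) <= e.
Proof.
split=> [cMx e e0|h B /nbhs_ballP[e /= e0 xB]].
  have [y [My]] := cMx (ball x e%:C) (nbhsx_ballx _ _ (etrans (ltcR _ _) e0)).
  by rewrite -ball_normE /= nrmE ltcR => /ltW; exists y.
have e0' : 0 < complex.Re e by move: e0; rewrite ltcE => /andP[].
have eE : e = (complex.Re e)%:C by rewrite RRe_real ?gtr0_real.
have /h[y My xy] : 0 < complex.Re e / 2 by rewrite divr_gt0.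
exists y; split=> //; apply: xB; rewrite -ball_normE /= nrmE eE ltcR.
by rewrite (le_lt_trans xy)// ltr_pdivrMr// mulr2n mulrDr mulr1 ltrDl.
Qed.

(** To pass to the limit in an identity, it suffices to bound the defect by a
   fixed multiple of an arbitrary positive number. *)
Lemma nrm_eq_lim x y (C : R) : 0 <= C ->
  (forall e : R, 0 < e -> nrm (x - y) <= C * e) -> x = y.
Proof.
move=> C0 h; apply/eqP; rewrite -subr_eq0; apply/eqP/nrm_small => e e0.
have C1 : 0 < C + 1 by rewrite ltr_wpDl.
have /h/le_trans : 0 < e / (C + 1) by rewrite divr_gt0.
by apply; rewrite mulrCA -ler_pdivlMl// mulVf ?gt_eqF// ler_pdivrMr// mul1r lerDl.
Qed.

End Linear.

(** * Orthogonal projections *)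

Section Projections.
Context {R : realType} {H : completeNormedModType R[i]}.
Variable dot : {dot H for (@Num.conj R[i])}.
Hypothesis dot_norm : induces_norm dot.
Implicit Types (x y z : H) (c : R) (S T P Q : H -> H).
Local Notation rdot := (rdot dot).
Local Notation oproj := (orthogonal_projection dot).

Lemma rdot_ext x y : (forall z, rdot x z = rdot y z) -> x = y.
Proof.
move=> h; apply/eqP; rewrite -subr_eq0; apply/eqP/nrm_eq0/eqP.
by rewrite -sqrf_eq0 (nrm_sqr dot_norm) rdotBl h subrr.
Qed.

(** The imaginary part of dot x y is the real part of dot (- i x) y, so a real
   adjoint of a complex linear map is a complex one. *)
Lemma rdot_adjoint S T : linear S ->
  (forall x y, rdot (S x) y = rdot x (T y)) -> adjoint dot S T.
Proof.
move=> lS h x y; have h1 := h x y.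
have := h ('i%C *: x) y; rewrite /rdot (linZ _ _ lS) !linearZl_LR/= => h2.
move: h1 h2; rewrite /rdot; case: (dot _ _) => a b; case: (dot _ _) => a' b' /=.
by rewrite !mul0r !mul1r !sub0r => -> /oppr_inj ->.
Qed.

Lemma oproj_linear P : oproj P -> linear P.
Proof. by case=> -[]. Qed.

Lemma oprojK P x : oproj P -> P (P x) = P x.
Proof. by case=> _ PP _; have := congr1 (@^~ x) PP. Qed.

Lemma oproj_rdot P x y : oproj P -> rdot (P x) y = rdot x (P y).
Proof. by case=> _ _ Pa; exact: adjoint_rdot. Qed.

Lemma idem_contraction P : (forall x, P (P x) = P x) ->
  (forall x y, rdot (P x) y = rdot x (P y)) -> forall x, nrm (P x) <= nrm x.
Proof.
move=> PP Pa x; have := nrm_ge0 (P x); rewrite le_eqVlt => /orP[/eqP<-|px].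
  exact: nrm_ge0.
rewrite -(ler_pM2l px) -expr2 (nrm_sqr dot_norm) Pa PP -Pa.
exact: cauchy_schwarz.
Qed.

Lemma oproj_bound P : oproj P -> opbound P 1.
Proof.
move=> oP; apply/opboundE; split=> // x; rewrite mul1r.
by apply: idem_contraction => [{}x|{}x y]; [exact: oprojK|exact: oproj_rdot].
Qed.

Lemma oproj_nrm_le P x : oproj P -> nrm (P x) <= nrm x.
Proof. by move/oproj_bound/opboundE => -[_ /(_ x)]; rewrite mul1r. Qed.

Lemma oprojI P : linear P -> (forall x, P (P x) = P x) ->
  (forall x y, rdot (P x) y = rdot x (P y)) -> oproj P.
Proof.
move=> lP PP Pa; split; last exact: rdot_adjoint.
- split=> //; exists 1; apply/opboundE; split=> // x; rewrite mul1r.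
  exact: idem_contraction.
- by apply/funext => x /=.
Qed.

Lemma range_oproj P x : oproj P -> range P x <-> P x = x.
Proof.
move=> oP; split=> [[y _ <-]|<-]; first exact: oprojK.
by exists x.
Qed.

Lemma proj_leP P Q : oproj Q -> proj_le P Q <-> forall x, Q (P x) = P x.
Proof.
move=> oQ; split=> [PQ x|QP _ [x _ <-]].
  by apply/(range_oproj _ oQ); apply: PQ; exists x.
by apply/(range_oproj _ oQ).
Qed.

Lemma proj_le_absorb P Q x : oproj P -> oproj Q -> proj_le P Q ->
  P (Q x) = P x.
Proof.
move=> oP oQ /(proj_leP _ oQ) QP; apply: rdot_ext => z.
by rewrite !oproj_rdot// QP.
Qed.

Lemma proj_le_anti P Q : oproj P -> oproj Q ->
  proj_le P Q -> proj_le Q P -> P = Q.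
Proof.
move=> oP oQ PQ /(proj_leP _ oP) QP; apply/funext => x.
by rewrite -(proj_le_absorb _ oP oQ PQ) QP.
Qed.

Lemma proj_le_trans P Q S : proj_le P Q -> proj_le Q S -> proj_le P S.
Proof. by move=> PQ QS x /PQ /QS. Qed.

Lemma closed_range_oproj P : oproj P -> closed (range P).
Proof.
move=> oP x /closure_nrmP h; apply/(range_oproj _ oP).
apply: (@nrm_eq_lim _ _ _ _ 2) => // e e0.
have [y /(range_oproj _ oP) Py xy] := h _ e0.
rewrite (le_trans (nrm_dist_le _ y _))// mulr2n mulrDl mul1r lerD//.
  rewrite -{1}Py -linB; last exact: oproj_linear.
  exact: le_trans (oproj_nrm_le _ oP) xy.
by rewrite nrmBC.
Qed.

(** Pythagoras: Q x - P x is orthogonal to P x. *)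
Lemma nrm_sqr_le_proj P Q x : oproj P -> oproj Q -> proj_le P Q ->
  nrm (Q x - P x) ^+ 2 = nrm (Q x) ^+ 2 - nrm (P x) ^+ 2.
Proof.
move=> oP oQ PQ; rewrite (nrm_sqrB dot_norm).
have -> : rdot (Q x) (P x) = nrm (P x) ^+ 2; last by ring.
rewrite (nrm_sqr dot_norm) (rdotC _ (Q x)) !(oproj_rdot _ _ oP).
by rewrite (proj_le_absorb _ oP oQ PQ) (oprojK _ oP).
Qed.

End Projections.

(** * Decreasing nets of projections *)

Section DirectedInf.
Context {R : realType} {H : completeNormedModType R[i]}.
Variable dot : {dot H for (@Num.conj R[i])}.
Hypothesis dot_norm : induces_norm dot.
Local Notation rdot := (rdot dot).
Local Notation oproj := (orthogonal_projection dot).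
Variable D : set (H -> H).
Hypothesis D_proj : D `<=` oproj.
Hypothesis D_nonempty : D !=set0.
Hypothesis D_directed : forall P Q, D P -> D Q ->
  exists N, [/\ D N, proj_le N P & proj_le N Q].

Let limit_at (z l : H) := forall e : R, 0 < e ->
  exists2 Q, D Q & forall Q', D Q' -> proj_le Q' Q -> nrm (Q' z - l) <= e.

(** The squared norms |Q z|^2 decrease along D, and by Pythagoras their
   oscillation controls that of the vectors Q z. *)
Let limit_exists z : exists l, limit_at z l.
Proof.
pose V := [set nrm (Q z) ^+ 2 | Q in D].
have infV : has_inf V.
  have [P DP] := D_nonempty; split; first by exists (nrm (P z) ^+ 2), P.
  by exists 0 => _ [Q _ <-]; exact: sqr_ge0.
have pick (n : nat) : exists Q, D Q /\
    forall Q', D Q' -> proj_le Q' Q -> nrm (Q z - Q' z) <= n.+1%:R^-1.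
  have e0 : 0 < (n.+1%:R^-1 : R) ^+ 2 by rewrite exprn_gt0// invr_gt0 ltr0Sn.
  have [_ [Q DQ <-] Qlt] := inf_adherent e0 infV.
  exists Q; split=> // Q' DQ' Q'Q.
  rewrite -(@ler_pXn2r _ 2)// ?nnegrE ?nrm_ge0 ?invr_ge0 ?ler0n//.
  rewrite (nrm_sqr_le_proj dot_norm _ (D_proj DQ') (D_proj DQ) Q'Q).
  have : inf V <= nrm (Q' z) ^+ 2.
    by apply: ge_inf; [exact: infV.2|exists Q'].
  by move=> infle; rewrite lerBlDr addrC (le_trans (ltW Qlt))// lerD2r.
have [Qn /all_and2[DQ QnP]] := choice pick.
have cauchyQ m n : nrm (Qn m z - Qn n z) <= m.+1%:R^-1 + n.+1%:R^-1.
  have [N [DN Nm Nn]] := D_directed (DQ m) (DQ n).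
  rewrite (le_trans (nrm_dist_le _ (N z) _))// lerD// ?QnP//.
  by rewrite nrmBC QnP.
have small (e : R) : 0 < e ->
    exists N, forall n, (N <= n)%N -> (n.+1%:R^-1 : R) <= e.
  move=> e0; exists (Num.truncn e^-1) => n Nn.
  rewrite -[e]invrK lef_pV2 ?posrE ?invr_gt0//.
  by rewrite (le_trans (ltW (truncnS_gt _)))// ler_nat.
have [|l ul] := @nrm_complete _ _ (fun n => Qn n z).
  move=> e e0; have [N Ne] := small (e / 2) (divr_gt0 e0 (ltr0Sn _ _)).
  exists N => m n Nm Nn; rewrite (le_trans (cauchyQ m n))// [e in _ <= e]splitr.
  by rewrite lerD// Ne.
exists l => e e0.
have [N Ne] := small (e / 2) (divr_gt0 e0 (ltr0Sn _ _)).
have [M Me] := ul (e / 2) (divr_gt0 e0 (ltr0Sn _ _)).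
exists (Qn (maxn N M)); first exact: DQ.
move=> Q' DQ' Q'Q; rewrite (le_trans (nrm_dist_le _ (Qn (maxn N M) z) _))//.
rewrite [e in _ <= e]splitr lerD//; last by rewrite Me// leq_maxr.
by rewrite nrmBC (le_trans (QnP _ _ DQ' Q'Q))// Ne// leq_maxl.
Qed.

(** At each vector the net is Cauchy, since its squared norms decrease; the
   properties of the pointwise limit are read off a common lower bound of the
   finitely many members of D that they involve. The last clause is the form of
   convergence used below, whereas the second one lets strongly closed sets
   inherit the limit. *)
Lemma directed_inf : exists P, [/\ oproj P,
  closure (D : set {ptws H -> H}) P,
  forall Q, D Q -> proj_le P Q &
  forall z (e : R), 0 < e -> exists2 Q, D Q & nrm (Q z - P z) <= e].
Proof.
have [P limP] := choice limit_exists.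
have le_refl (Q : H -> H) : proj_le Q Q by [].
have common2 z1 z2 (e : R) : 0 < e -> exists Q, [/\ D Q,
    nrm (Q z1 - P z1) <= e & nrm (Q z2 - P z2) <= e].
  move=> e0; have [Q1 D1 h1] := limP z1 _ e0; have [Q2 D2 h2] := limP z2 _ e0.
  have [N [DN N1 N2]] := D_directed D1 D2.
  by exists N; split=> //; [exact: h1|exact: h2].
have below z Q (e : R) : D Q -> 0 < e -> exists Q', [/\ D Q',
    proj_le Q' Q & nrm (Q' z - P z) <= e].
  move=> DQ e0; have [Q1 D1 h1] := limP z _ e0.
  have [N [DN N1 N2]] := D_directed D1 DQ.
  by exists N; split=> //; exact: h1.
have linP : linear P.
  move=> a x y; have [r r0 nrmZC] := @nrm_scaleC R H a.
  apply: (@nrm_eq_lim _ _ _ _ (1 + (r + 1))).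
    by rewrite !addr_ge0.
  move=> e e0; have [Q1 [D1 x1 y1]] := common2 x y _ e0.
  have [Q2 D2 h2] := limP (a *: x + y) _ e0.
  have [Q3 D3 h3] := limP x _ e0; have [Q4 D4 h4] := limP y _ e0.
  have [N1 [DN1 N12 N13]] := D_directed D2 D3.
  have [N [DN NN1 N4]] := D_directed DN1 D4.
  have {}h2 := h2 _ DN (proj_le_trans NN1 N12).
  have {}h3 := h3 _ DN (proj_le_trans NN1 N13).
  have {}h4 := h4 _ DN N4.
  rewrite (le_trans (nrm_dist_le _ (N (a *: x + y)) _))// mulrDl mul1r lerD//.
    by rewrite nrmBC.
  rewrite (oproj_linear (D_proj DN)) opprD addrACA -scalerBr.
  by rewrite (le_trans (nrmD _ _))// mulrDl mul1r lerD// nrmZC ler_wpM2l.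
have PQ Q z : D Q -> P (Q z) = P z.
  move=> DQ; apply: (@nrm_eq_lim _ _ _ _ 2) => // e e0.
  have [Q1 D1 h1] := limP (Q z) _ e0; have [Q2 D2 h2] := limP z _ e0.
  have [N1 [DN1 N11 N12]] := D_directed D1 D2.
  have [N [DN NN1 NQ]] := D_directed DN1 DQ.
  rewrite (le_trans (nrm_dist_le _ (N (Q z)) _))// mulr2n mulrDl mul1r lerD//.
    by rewrite nrmBC h1//; exact: proj_le_trans N11.
  rewrite (proj_le_absorb dot_norm _ (D_proj DN) (D_proj DQ) NQ) h2//.
  exact: proj_le_trans N12.
have QP Q z : D Q -> Q (P z) = P z.
  move=> DQ; have oQ := D_proj DQ; apply: (@nrm_eq_lim _ _ _ _ 2) => // e e0.
  have [N [DN NQ h]] := below z Q _ DQ e0.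
  rewrite (le_trans (nrm_dist_le _ (N z) _))// mulr2n mulrDl mul1r lerD//.
  rewrite -[N z]((proj_leP _ oQ).1 NQ z) -(linB _ _ (oproj_linear oQ)).
  by rewrite (le_trans (oproj_nrm_le dot_norm _ oQ))// nrmBC.
have PP z : P (P z) = P z.
  apply: (@nrm_eq_lim _ _ _ _ 1) => // e e0; rewrite mul1r.
  have [Q DQ h] := limP (P z) _ e0.
  by have := h _ DQ (le_refl _); rewrite nrmBC (QP Q).
have Pa x y : rdot (P x) y = rdot x (P y).
  apply/eqP; rewrite -subr_eq0; apply/eqP/abs_small => e e0.
  have C0 : 0 < nrm y + nrm x + 1 by rewrite ltr_wpDl// addr_ge0// nrm_ge0.
  have d0 : 0 < e / (nrm y + nrm x + 1) by rewrite divr_gt0.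
  have [Q [DQ hx hy]] := common2 x y _ d0.
  have -> : rdot (P x) y - rdot x (P y) =
      rdot (P x - Q x) y + rdot x (Q y - P y).
    by rewrite rdotBl rdotBr (oproj_rdot _ _ (D_proj DQ)); ring.
  have cs := abs_cauchy_schwarz dot_norm.
  rewrite (le_trans (ler_normD _ _))// (le_trans (lerD (cs _ _) (cs _ _)))//.
  rewrite nrmBC (mulrC _ (nrm y)).
  have h1 := ler_wpM2l (nrm_ge0 y) hx; have h2 := ler_wpM2l (nrm_ge0 x) hy.
  rewrite (le_trans (lerD h1 h2))// -mulrDl mulrA ler_pdivrMr// mulrC.
  by rewrite ler_pM2l// lerDl.
exists P; split; first exact: oprojI.
- pose F : set_system {ptws H -> H} := [set X | exists2 Q, D Q &
    forall Q', D Q' -> proj_le Q' Q -> X Q'].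
  have FF : Filter F.
    split.
    + by have [Q DQ] := D_nonempty; exists Q.
    + move=> X Y [Q DQ XQ] [Q' DQ' YQ']; have [N [DN NQ NQ']] := D_directed DQ DQ'.
      exists N => // M DM MN; split.
        by apply: XQ => //; exact: proj_le_trans NQ.
      by apply: YQ' => //; exact: proj_le_trans NQ'.
    + by move=> X Y XY [Q DQ XQ]; exists Q => // Q' DQ' /(XQ _ DQ')/XY.
  have FP : {ptws, F --> P}.
    apply/pointwise_cvgP => t; apply/cvgrPdist_le => e e0.
    have e0' : 0 < complex.Re e by move: e0; rewrite ltcE => /andP[].
    have eE : e = (complex.Re e)%:C by rewrite RRe_real ?gtr0_real.
    have [Q DQ h] := limP t _ e0'; exists Q => // Q' DQ' Q'Q.
    by rewrite /= nrmE eE lecR nrmBC h.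
  move=> B /FP[Q DQ BQ]; exists Q; split=> //; exact: BQ.
- by move=> Q DQ; apply/(proj_leP _ (D_proj DQ)) => z; exact: QP.
- by move=> z e /limP-/(_ z)[Q DQ h]; exists Q => //; exact: h.
Qed.

End DirectedInf.

(** * Lattice operations and atoms *)

Section Lattice.
Context {R : realType} {H : completeNormedModType R[i]}.
Variable dot : {dot H for (@Num.conj R[i])}.
Hypothesis dot_norm : induces_norm dot.
Local Notation rdot := (rdot dot).
Local Notation oproj := (orthogonal_projection dot).
Variable L : set (H -> H).
Hypothesis L_csl : csl dot L.
Implicit Types (x y z : H) (E F G P Q U : H -> H).

Lemma L_oproj P : L P -> oproj P.
Proof. exact: csl_proj. Qed.

Lemma L_linear P : L P -> linear P.
Proof. by move/L_oproj/oproj_linear. Qed.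

Lemma L_comm P Q x : L P -> L Q -> P (Q x) = Q (P x).
Proof. by move=> LP LQ; have := congr1 (@^~ x) (csl_comm L_csl LP LQ). Qed.

(** Commuting projections have their product as meet. *)
Lemma L_meet P Q : L P -> L Q -> L (P \o Q).
Proof.
move=> LP LQ; have [oP oQ] := (L_oproj LP, L_oproj LQ).
have [N LN NE] := csl_meet L_csl LP LQ.
have oPQ : oproj (P \o Q).
  apply: (oprojI dot_norm) => [|x|x y] /=.
  - by apply: linear_comp; exact: L_linear.
  - by rewrite -(L_comm _ LP LQ) (oprojK _ oQ) (oprojK _ oP).
  - by rewrite (oproj_rdot _ _ oP) (oproj_rdot _ _ oQ) L_comm.
suff -> : P \o Q = N by [].
have PQN x : range N x <-> range (P \o Q) x.
  rewrite NE; split=> [[/(range_oproj _ oP) Px /(range_oproj _ oQ) Qx]|[y _ <-]].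
    by apply/(range_oproj _ oPQ); rewrite /= Qx.
  split; first by exists (Q y).
  by rewrite /= L_comm//; exists (P y).
by apply: (proj_le_anti dot_norm oPQ (L_oproj LN)) => x /PQN.
Qed.

Definition proj_join P Q : H -> H := P + Q - (P \o Q).

Lemma proj_joinE P Q x : proj_join P Q x = P x + Q x - P (Q x).
Proof. by []. Qed.

Lemma proj_join_oproj P Q : L P -> L Q -> oproj (proj_join P Q).
Proof.
move=> LP LQ; have [oP oQ] := (L_oproj LP, L_oproj LQ).
have [lP lQ] := (L_linear LP, L_linear LQ).
apply: (oprojI dot_norm) => [|x|x y].
- apply: linear_sub; first exact: linear_add.
  exact: linear_comp.
- rewrite !proj_joinE (linB _ _ lQ) !(linB _ _ lP) (linD _ _ lQ) !(linD _ _ lP).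
  rewrite -!(L_comm _ LP LQ) !(oprojK _ oP) !(oprojK _ oQ).
  by rewrite !addrK (addrC (P (Q x)) (Q x)) addrK.
- rewrite !proj_joinE !rdotE !(oproj_rdot _ _ oP) !(oproj_rdot _ _ oQ).
  by rewrite -(L_comm _ LP LQ).
Qed.

(** The range of P + Q - P Q is the plain sum of the ranges of P and Q, which is
   therefore already closed. *)
Lemma L_join P Q : L P -> L Q -> L (proj_join P Q).
Proof.
move=> LP LQ; have [oP oQ] := (L_oproj LP, L_oproj LQ).
have oJ := proj_join_oproj LP LQ.
have [N LN NE] := csl_join L_csl LP LQ.
suff -> : proj_join P Q = N by [].
apply: (proj_le_anti dot_norm oJ (L_oproj LN)) => x.
  move=> [y _ <-]; rewrite NE; apply: subset_closure.
  exists (P y); first by exists y.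
  exists (Q (y - P y)); first by exists (y - P y).
  by rewrite proj_joinE (linB _ _ (L_linear LQ)) -(L_comm _ LP LQ) addrA.
rewrite NE => cx; apply: (closed_range_oproj dot_norm oJ).
apply: closure_subset cx.
move=> _ [y /(range_oproj _ oP) Py] [z /(range_oproj _ oQ) Qz <-].
apply/(range_oproj _ oJ); rewrite proj_joinE !(linD _ _ (L_linear LQ)) Qz.
rewrite !(linD _ _ (L_linear LP)) Py (L_comm _ LP LQ) Py.
by rewrite (addrC (Q y) z) addrACA (addrC (Q y)) addrK.
Qed.

Definition smallest_over (S : set H) P := [/\ L P, S `<=` range P &
  forall Q, L Q -> S `<=` range Q -> proj_le P Q].

(** The members of L over S form a family directed downwards by products, whose
   strong limit stays in L because L is strongly closed. *)
Lemma smallest_over_exists (S : set H) : exists P, smallest_over S P.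
Proof.
pose D := [set Q | L Q /\ S `<=` range Q].
have [|||P [oP cP DP apx]] := @directed_inf _ _ _ dot_norm D.
- by move=> Q [/L_oproj].
- exists id; split; first exact: csl_top L_csl.
  by move=> x _; exists x.
- move=> P Q [LP SP] [LQ SQ]; exists (P \o Q); split.
  + split; first exact: L_meet.
    move=> x Sx; apply/(range_oproj _ (L_oproj (L_meet LP LQ))) => /=.
    rewrite ((range_oproj _ (L_oproj LQ)).1 (SQ _ Sx)).
    exact: ((range_oproj _ (L_oproj LP)).1 (SP _ Sx)).
  + by move=> _ [x _ <-]; exists (Q x).
  + by move=> _ [x _ <-]; rewrite /= L_comm//; exists (P x).
have LP : L P.
  apply: (csl_closed L_csl); split; last by case: oP.
  by apply: closure_subset cP => Q [].
exists P; split=> // [x Sx|Q LQ SQ]; last exact: DP.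
apply/(range_oproj _ oP)/(@nrm_eq_lim _ _ _ _ 1) => // e e0.
have [Q [LQ SQ]] := apx x e e0.
by rewrite ((range_oproj _ (L_oproj LQ)).1 (SQ _ Sx)) mul1r nrmBC.
Qed.

Lemma sub_oproj P Q : L P -> L Q -> proj_le Q P -> oproj (P - Q).
Proof.
move=> LP LQ QP; have [oP oQ] := (L_oproj LP, L_oproj LQ).
have E z : (P - Q) z = P z - Q z by [].
have PQ z := (proj_leP Q oP).1 QP z.
apply: (oprojI dot_norm) => [|x|x y].
- by apply: linear_sub; exact: L_linear.
- rewrite !E (linB _ _ (L_linear LP)) (linB _ _ (L_linear LQ)).
  rewrite (oprojK _ oP) (oprojK _ oQ).
  by rewrite PQ (L_comm _ LQ LP) PQ subrr subr0.
- by rewrite !E !rdotE (oproj_rdot _ _ oP) (oproj_rdot _ _ oQ).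
Qed.

Lemma atom_oproj E : atom L E -> oproj E.
Proof.
by move=> [[_ [P [Q [LP LQ QP ->]]]] _]; exact: sub_oproj.
Qed.

Lemma atom_linear E : atom L E -> linear E.
Proof. by move/atom_oproj/oproj_linear. Qed.

Lemma atom_comm E P x : atom L E -> L P -> E (P x) = P (E x).
Proof.
move=> [[_ [P' [Q' [LP LQ QP ->]]]] _] L'.
have E1 z : (P' - Q') z = P' z - Q' z by [].
by rewrite !E1 (linB _ _ (L_linear L')) !(L_comm x _ L').
Qed.

(** Cutting an atom by a member of L yields an interval, hence all or nothing. *)
Lemma atom_dichotomy E P : atom L E -> L P ->
  (forall x, P (E x) = E x) \/ (forall x, P (E x) = 0).
Proof.
move=> aE LP; have [P0|P0] := pselect (P \o E = 0).
  by right=> x; have := congr1 (@^~ x) P0.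
left=> x; suff PE : P \o E = E by have := congr1 (@^~ x) PE.
have [[_ [P' [Q' [LP' LQ' QP' EE]]]] minE] := aE.
apply: minE; last first.
  by move=> _ [z _ <-]; rewrite /= -(atom_comm _ aE LP); exists (P z).
split=> //; exists (P \o P'), (P \o Q'); split; [exact: L_meet|exact: L_meet| |].
  apply/(proj_leP _ (L_oproj (L_meet LP LP'))) => z /=.
  rewrite (L_comm (Q' z) LP' LP) (oprojK _ (L_oproj LP)).
  by rewrite ((proj_leP _ (L_oproj LP')).1 QP').
apply/funext => z; rewrite -[RHS]/(P (P' z) - P (Q' z)) /=.
by rewrite -(linB _ _ (L_linear LP)) EE.
Qed.

(** If G does not annihilate E, the dichotomy at both ends of the interval G
   places E below G, and G is minimal. *)
Lemma atom_ortho E G x : atom L E -> atom L G -> E <> G -> G (E x) = 0.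
Proof.
move=> aE aG EG.
have [[G0 [P [Q [LP LQ QP GE]]]] minG] := aG.
have Gz z : G z = P z - Q z by rewrite GE.
have PQ z := (proj_leP Q (L_oproj LP)).1 QP z.
have [PE|PE] := atom_dichotomy aE LP; have [QE|QE] := atom_dichotomy aE LQ.
- by rewrite Gz PE QE subrr.
- case: EG; have [[E0 _] minE] := aE; apply: minG aE.1 _.
  by move=> _ [z _ <-]; exists (E z) => //; rewrite Gz PE QE subr0.
- have PEx : P (E x) = E x by rewrite -[E x](QE x) PQ.
  by rewrite Gz QE PEx subrr.
- by rewrite Gz PE QE subrr.
Qed.

(** An atom P - Q is cut out of its hull U by U Q: the hull is itself the upper
   end of an interval representing the atom. *)
Lemma atom_hull E : atom L E -> exists U F,
  [/\ smallest_over (range E) U, L F, proj_le F U & E = U - F].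
Proof.
move=> aE; have [U [LU EU minU]] := smallest_over_exists (range E).
have [[_ [P [Q [LP LQ QP EE]]]] _] := aE.
have Ez z : E z = P z - Q z by rewrite EE.
have UE z : U (E z) = E z.
  by apply/(range_oproj _ (L_oproj LU))/EU; exists z.
have PQ z := (proj_leP Q (L_oproj LP)).1 QP z.
have UP : proj_le U P.
  apply: minU => // _ [z _ <-]; apply/(range_oproj _ (L_oproj LP)).
  by rewrite Ez (linB _ _ (L_linear LP)) (oprojK _ (L_oproj LP)) PQ.
exists U, (U \o Q); split => //; first exact: L_meet.
  by move=> _ [z _ <-]; exists (Q z).
apply/funext => z; rewrite -UE Ez (linB _ _ (L_linear LU)).
by rewrite (proj_le_absorb dot_norm _ (L_oproj LU) (L_oproj LP) UP).
Qed.

Lemma atom_neq0 E : atom L E -> exists x, E x <> 0.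
Proof.
move=> [[E0 _] _]; apply: contrapT => h; apply: E0; apply/funext => x.
by apply: contrapT => Ex; apply: h; exists x.
Qed.

End Lattice.

(** * Norm closed operator algebras *)

Section NormClosed.
Context {R : realType} {H : completeNormedModType R[i]}.
Implicit Types (x y z : H) (S T : H -> H) (A : set (H -> H)).

Lemma norm_closed_opbound A T : norm_closed A -> bounded_operators T ->
  (forall e : R, 0 < e -> exists2 S, A S & opbound (T - S) e) -> A T.
Proof.
move=> Acl bT h; apply: Acl => // e e0.
have e2 : 0 < e / 2 by rewrite divr_gt0.
have [S AS TS] := h _ e2; exists S => //.
apply: le_lt_trans (_ : e / 2 < e); last first.
  by rewrite ltr_pdivrMr// mulr2n mulrDr mulr1 ltrDl.
by apply: ge_inf => //; exists 0 => M [].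
Qed.

Section Algebra.
Variable A : set (H -> H).
Hypothesis A_alg : operator_algebra A.

Lemma alg_linear T : A T -> linear T.
Proof. by case: A_alg => + _ _ => /[apply] -[]. Qed.

Lemma alg_bounded T : A T -> exists M : R, opbound T M.
Proof. by case: A_alg => + _ _ => /[apply] -[]. Qed.

Lemma alg0 : A 0.
Proof. by case: A_alg => _ [/set_mem]. Qed.

Lemma alg_lincomb (a : R[i]) S T : A S -> A T -> A (a *: S + T).
Proof.
case: A_alg => _ [_ h] _ AS AT; apply/set_mem/h; exact/mem_set.
Qed.

Lemma alg_add S T : A S -> A T -> A (S + T).
Proof. by move=> AS AT; rewrite -[S]scale1r; exact: alg_lincomb. Qed.

Lemma alg_scale (a : R[i]) T : A T -> A (a *: T).
Proof.
by move=> AT; rewrite -[_ *: _]addr0; apply: alg_lincomb => //; exact: alg0.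
Qed.

Lemma alg_sub S T : A S -> A T -> A (S - T).
Proof. by move=> AS AT; rewrite addrC -scaleN1r; exact: alg_lincomb. Qed.

Lemma alg_comp S T : A S -> A T -> A (S \o T).
Proof. by case: A_alg => _ _; exact. Qed.

Lemma alg_sum (T : nat -> H -> H) n : (forall j, A (T j)) ->
  A (\sum_(j < n) T j).
Proof.
move=> AT; elim: n => [|n IH]; first by rewrite big_ord0; exact: alg0.
by rewrite big_ord_recr; exact: alg_add.
Qed.

End Algebra.

Lemma geometric_small (C q e : R) : 0 <= q < 1 -> 0 < e ->
  exists N, forall n, (N <= n)%N -> C * q ^+ n <= e.
Proof.
move=> /andP[q0 q1] e0.
have /cvgrPdist_le/(_ (e / (`|C| + 1))) : (q ^+ n @[n --> \oo] --> (0 : R))%classic.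
  by apply: cvg_expr; rewrite ger0_norm.
have C1 : 0 < `|C| + 1 by rewrite ltr_wpDl.
rewrite divr_gt0// => /(_ erefl)[N _ h]; exists N => n /h /=.
rewrite sub0r normrN ger0_norm ?exprn_ge0// ler_pdivlMr// mulrC => h'.
rewrite (le_trans _ h')// ler_wpM2r ?exprn_ge0//.
by rewrite (le_trans (ler_norm C))// lerDl.
Qed.

Lemma nrm_le_geometric x (C q : R) : 0 <= q < 1 ->
  (forall n, nrm x <= C * q ^+ n) -> x = 0.
Proof.
move=> q01 h; apply: nrm_small => e e0.
have [N hN] := geometric_small C q01 e0.
exact: le_trans (h N) (hN N (leqnn _)).
Qed.

Section Series.
Variable A : set (H -> H).
Hypothesis A_alg : operator_algebra A.
Hypothesis A_closed : norm_closed A.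

(** Both the membership of a Neumann series in A and the exactness of successive
   approximations rest on this summation; the case n = 0 bounds the sum. *)
Lemma geometric_series (T : nat -> H -> H) (C q : R) :
  0 <= C -> 0 <= q < 1 ->
  (forall n, A (T n)) -> (forall n, opbound (T n) (C * q ^+ n)) ->
  exists2 S, A S &
    forall n, opbound (S - \sum_(j < n) T j) (C / (1 - q) * q ^+ n).
Proof.
move=> C0 q01 AT Tb; have /andP[q0 q1] := q01.
have q1' : 0 < 1 - q by rewrite subr_gt0.
pose s n := \sum_(j < n) T j.
have As n : A (s n) by exact: (alg_sum A_alg).
have sS n z : s n.+1 z = s n z + T n z by rewrite /s big_ord_recr.
have D0 : 0 <= C / (1 - q) by rewrite divr_ge0// ltW.
have step n k z : nrm (s (n + k)%N z - s n z) <=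
    C / (1 - q) * (q ^+ n - q ^+ (n + k)) * nrm z.
  elim: k => [|k IH]; first by rewrite addn0 !subrr mulr0 mul0r nrm0.
  rewrite addnS sS addrAC (le_trans (nrmD _ _))//.
  have /opboundE[_ /(_ z) Tz] := Tb (n + k)%N.
  apply: (le_trans (lerD IH Tz)); rewrite -mulrDl ler_wpM2r ?nrm_ge0//.
  have -> : C * q ^+ (n + k) = C / (1 - q) * (q ^+ (n + k) - q ^+ (n + k).+1).
    by rewrite exprS; field; rewrite gt_eqF.
  by rewrite -mulrDr addrA subrK.
have tail n m z : (n <= m)%N -> nrm (s m z - s n z) <= C / (1 - q) * nrm z * q ^+ n.
  move=> /subnKC <-; rewrite (le_trans (step _ _ _))// mulrAC.
  apply: ler_wpM2l; first by rewrite mulr_ge0 ?nrm_ge0.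
  by rewrite gerBl exprn_ge0.
have lim z : exists l, forall e : R, 0 < e ->
    exists N, forall n, (N <= n)%N -> nrm (s n z - l) <= e.
  apply: nrm_complete => e e0.
  have [N hN] := geometric_small (C / (1 - q) * nrm z) q01 e0.
  exists N => m n Nm Nn; have [mn|/ltnW nm] := leqP m n.
    by rewrite nrmBC (le_trans (tail _ _ _ mn))// hN.
  by rewrite (le_trans (tail _ _ _ nm))// hN.
have [S Slim] := choice lim.
have Stail n z : nrm (S z - s n z) <= C / (1 - q) * q ^+ n * nrm z.
  apply/ler_addgt0Pr => e e0; have [N hN] := Slim z e e0.
  rewrite (le_trans (nrm_dist_le _ (s (maxn N n) z) _))// addrC lerD//.
    by rewrite mulrAC tail// leq_maxr.
  by rewrite nrmBC hN// leq_maxl.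
have Sb n : opbound (S - s n) (C / (1 - q) * q ^+ n).
  apply/opboundE; split; first by rewrite mulr_ge0// exprn_ge0.
  exact: Stail.
have linS : linear S.
  move=> a x y; apply/eqP; rewrite -subr_eq0; apply/eqP.
  have [r r0 nrmZC] := @nrm_scaleC R H a.
  apply: (@nrm_le_geometric _ (C / (1 - q) * (nrm (a *: x + y) + r * nrm x
    + nrm y)) q q01) => n.
  have -> : S (a *: x + y) - (a *: S x + S y) =
      (S (a *: x + y) - s n (a *: x + y)) - (a *: (S x - s n x) + (S y - s n y)).
    rewrite (alg_linear A_alg (As n)) scalerBr.
    by rewrite [in X in _ = X]addrACA -opprD opprB addrA subrK.
  rewrite (le_trans (nrmB _ _))//.
  have h1 := Stail n (a *: x + y); have h2 := Stail n x; have h3 := Stail n y.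
  have h4 : nrm (a *: (S x - s n x) + (S y - s n y)) <=
      r * (C / (1 - q) * q ^+ n * nrm x) + C / (1 - q) * q ^+ n * nrm y.
    by rewrite (le_trans (nrmD _ _))// lerD// nrmZC ler_wpM2l.
  rewrite (le_trans (lerD h1 h4))// le_eqVlt; apply/orP; left.
  by apply/eqP; ring.
exists S => //; apply: norm_closed_opbound => //.
  split=> //; have [M sM] := alg_bounded A_alg (As 0%N).
  exists (C / (1 - q) * q ^+ 0 + M).
  by have -> : S = (S - s 0%N) + s 0%N; [rewrite subrK|exact: opbound_add].
move=> e e0; have [N hN] := geometric_small (C / (1 - q)) q01 e0.
by exists (s N) => //; exact: opbound_le (Sb N) (hN _ (leqnn _)).
Qed.

End Series.
End NormClosed.

(** * Successive approximation and contractions *)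

Section Solve.
Context {R : realType} {H : completeNormedModType R[i]}.
Variable A : set (H -> H).
Hypothesis A_alg : operator_algebra A.
Hypothesis A_closed : norm_closed A.

(** As in the open mapping theorem: the errors y - T x are treated in turn, each
   half as large as the previous one, and the corrections sum up in A. *)
Lemma solve_by_halving (x : H) (Y : set H) (C : R) : 0 <= C ->
  (forall y, Y y -> exists T, [/\ A T, opbound T (C * nrm y),
     Y (y - T x) & nrm (y - T x) <= nrm y / 2]) ->
  forall y, Y y -> exists T, [/\ A T, opbound T (2 * C * nrm y) & T x = y].
Proof.
move=> C0 step y Yy.
have /choice[f fP] : forall y', exists T, Y y' -> [/\ A T, opbound T (C * nrm y'),
    Y (y' - T x) & nrm (y' - T x) <= nrm y' / 2].
  move=> y'; have [/step[T hT]|nY] := pselect (Y y'); first by exists T.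
  by exists 0.
pose r n := iter n (fun y' => y' - f y' x) y.
have Yr n : Y (r n) by elim: n => [//|n /fP[]].
have rn n : nrm (r n) <= nrm y * (2^-1) ^+ n.
  elim: n => [|n IH]; first by rewrite mulr1.
  have [_ _ _ h] := fP _ (Yr n); apply: (le_trans h).
  by rewrite exprSr mulrA ler_wpM2r// invr_ge0.
have half01 : 0 <= (2^-1 : R) < 1 by apply/andP; split; lra.
have Cy0 : 0 <= C * nrm y by rewrite mulr_ge0// nrm_ge0.
have [||S AS Sb] := @geometric_series _ _ A A_alg A_closed (f \o r) (C * nrm y)
    (2^-1) Cy0 half01.
- by move=> n; have [] := fP _ (Yr n).
- move=> n; have [_ h _ _] := fP _ (Yr n).
  by apply: opbound_le h _; rewrite -mulrA ler_wpM2l.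
have sx n : (\sum_(j < n) (f \o r) j) x = y - r n.
  elim: n => [|n IH]; first by rewrite big_ord0 subrr.
  have -> : (\sum_(j < n.+1) (f \o r) j) x =
      (\sum_(j < n) (f \o r) j) x + f (r n) x by rewrite big_ord_recr.
  by rewrite IH /= opprB addrAC addrA.
exists S; split=> //.
  have := Sb 0%N; rewrite big_ord0 subr0 expr0 mulr1 => h.
  by apply: opbound_le h _; rewrite le_eqVlt; apply/orP; left; apply/eqP; field.
apply/eqP; rewrite -subr_eq0; apply/eqP.
apply: (@nrm_le_geometric _ _ _
  (C * nrm y / (1 - 2^-1) * nrm x + nrm y) _ half01) => n.
have -> : S x - y = (S x - (\sum_(j < n) (f \o r) j) x) - r n.
  by rewrite sx opprB addrA addrAC addrK.
have /opboundE[_ /(_ x) h] := Sb n.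
rewrite (le_trans (nrmB _ _))// mulrDl lerD ?rn//.
by rewrite mulrAC.
Qed.

Variable dot : {dot H for (@Num.conj R[i])}.
Hypothesis dot_norm : induces_norm dot.
Local Notation rdot := (rdot dot).

(** S is T (1 + T* T)^-1 = (1 + T T* )^-1 T, without mentioning inverses since A
   need not contain the identity. With c = 1 + M^2 and |T|, |T*| <= M, the
   operator K = 1 - (1 + T* T) / c has norm at most 1 - 1 / c, and S is the sum
   of the Neumann series c^-1 T K^n, each term of which lies in A. *)
Lemma regularized_exists T T' : A T -> A T' -> adjoint dot T T' ->
  exists S, [/\ A S, forall z, S z + S (T' (T z)) = T z &
    forall z, S z + T (T' (S z)) = T z].
Proof.
move=> AT AT' TT'.
have [lT lT'] := (alg_linear A_alg AT, alg_linear A_alg AT').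
have [M0 TM0] := alg_bounded A_alg AT; have [M1 TM1] := alg_bounded A_alg AT'.
have M00 : 0 <= M0 by have [] := TM0.
have M10 : 0 <= M1 by have [] := TM1.
pose M := M0 + M1.
have Mge0 : 0 <= M by rewrite addr_ge0.
have TM : opbound T M by apply: opbound_le TM0 _; rewrite lerDl.
have TM' : opbound T' M by apply: opbound_le TM1 _; rewrite lerDr.
pose c := 1 + M ^+ 2.
have c1 : 1 <= c by rewrite lerDl sqr_ge0.
have c0 : 0 < c by apply: lt_le_trans c1.
pose q := 1 - c^-1.
have q01 : 0 <= q < 1.
  by rewrite subr_ge0 invf_le1// c1 gtrBl invr_gt0.
have q0 : 0 <= q by case/andP: q01.
have qcE : q%:C = 1 - c^-1%:C by rewrite rmorphB.
have ccE : c%:C * c^-1%:C = 1 by rewrite -rmorphM mulfV// gt_eqF.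
(* The bound on K uses |T* T z| <= M |T z|, not the spectrum of T* T. *)
pose K z := q%:C *: z - c^-1%:C *: T' (T z).
have Kb : opbound K q.
  apply/opboundE; split=> // z.
  rewrite -(@ler_pXn2r _ 2)// ?nnegrE ?nrm_ge0//; last first.
    by rewrite mulr_ge0// nrm_ge0.
  rewrite (nrm_sqrB dot_norm) rdotZl rdotZr !nrmZ (ger0_norm q0).
  rewrite (ger0_norm (ltW (_ : 0 < c^-1))) ?invr_gt0//.
  rewrite -(adjoint_rdot _ _ TT') -(nrm_sqr dot_norm).
  have /opboundE[_ /(_ (T z)) h] := TM'.
  have h2 : nrm (T' (T z)) ^+ 2 <= M ^+ 2 * nrm (T z) ^+ 2.
    by rewrite -exprMn ler_pXn2r// nnegrE ?mulr_ge0 ?nrm_ge0.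
  rewrite !exprMn.
  have -> : q = (c - 1) * c^-1 by rewrite mulrBl mulfV ?gt_eqF// mul1r.
  move: h2; have -> : M ^+ 2 = c - 1 by rewrite /c addrAC subrr add0r.
  have ci : 0 <= c^-1 by rewrite invr_ge0 ltW.
  move: (nrm (T' _) ^+ 2) (sqr_ge0 (nrm (T z))) => u.
  move: (nrm (T z) ^+ 2) => t t0.
  move: (c^-1) ci => d d0 h2.
  suff : d ^+ 2 * u <= 2 * ((c - 1) * d * (d * t)) by lra.
  have -> : 2 * ((c - 1) * d * (d * t)) = d ^+ 2 * (2 * ((c - 1) * t)) by ring.
  rewrite ler_wpM2l ?sqr_ge0// (le_trans h2)//.
  have : 0 <= (c - 1) * t by rewrite mulr_ge0// subr_ge0.
  lra.
pose U n := iter n (fun V => V \o K) (c^-1%:C *: T).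
have US n z : U n.+1 z = U n (K z) by [].
have AU n : A (U n).
  elim: n => [|n IH]; first exact: alg_scale.
  have -> : U n.+1 = q%:C *: U n - c^-1%:C *: (U n \o (T' \o T)).
    apply/funext => z; rewrite US /K; have lU := alg_linear A_alg IH.
    by rewrite (linB _ _ lU) !(linZ _ _ lU).
  apply: alg_sub => //; first exact: alg_scale.
  by apply: alg_scale => //; do 2?apply: alg_comp => //.
have Ub n : opbound (U n) (c^-1 * M * q ^+ n).
  elim: n => [|n IH].
    have := opbound_scale c^-1 TM.
    by rewrite mulr1 ger0_norm// invr_ge0 ltW.
  by rewrite exprSr mulrA; exact: opbound_comp.
(* Since T (T* T) = (T T* ) T, the same recursion holds with 1 - (1 + T T* ) / c
   acting from the left. *)
have UK n z : U n.+1 z = q%:C *: U n z - c^-1%:C *: T (T' (U n z)).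
  elim: n z => [|n IH] z.
    rewrite US.
    have U0 w : U 0%N w = c^-1%:C *: T w by [].
    rewrite !U0 /K (linB _ _ lT) !(linZ _ _ lT) (linZ _ _ lT') (linZ _ _ lT).
    by rewrite scalerBr !scalerA (mulrC q%:C).
  by rewrite US IH.
have UKl n z : U n z + U n (T' (T z)) = c%:C *: (U n z - U n.+1 z).
  rewrite US /K; have lU := alg_linear A_alg (AU n).
  rewrite (linB _ _ lU) !(linZ _ _ lU) qcE scalerBl scale1r !scalerBr.
  by rewrite !scalerA ccE !scale1r !opprB [RHS]addrC addrA subrK addrC.
have UKr n z : U n z + T (T' (U n z)) = c%:C *: (U n z - U n.+1 z).
  rewrite UK qcE scalerBl scale1r !scalerBr.
  by rewrite !scalerA ccE !scale1r !opprB [RHS]addrC addrA subrK addrC.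
have cM0 : 0 <= c^-1 * M by rewrite mulr_ge0// invr_ge0 ltW.
have [S AS Sb] := geometric_series A_alg A_closed cM0 q01 AU Ub.
pose s n := \sum_(j < n) U j.
have sS n z : s n.+1 z = s n z + U n z by rewrite /s big_ord_recr.
have s0 z : s 0%N z = 0 by rewrite /s big_ord0.
have cU0 z : c%:C *: U 0%N z = T z.
  have -> : U 0%N z = c^-1%:C *: T z by [].
  by rewrite scalerA ccE scale1r.
(* Both identities for S hold for the partial sums up to c U_n, by telescoping. *)
have sl n z : s n z + s n (T' (T z)) = T z - c%:C *: U n z.
  elim: n => [|n IH]; first by rewrite !s0 addr0 cU0 subrr.
  by rewrite !sS addrACA IH UKl scalerBr addrA subrK.
have sr n z : s n z + T (T' (s n z)) = T z - c%:C *: U n z.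
  elim: n => [|n IH].
    by rewrite s0 (lin0 lT') (lin0 lT) addr0 cU0 subrr.
  by rewrite sS (linD _ _ lT') (linD _ _ lT) addrACA IH UKr scalerBr addrA subrK.
set B := c^-1 * M / (1 - q) in Sb.
have St n z : nrm (S z - s n z) <= B * q ^+ n * nrm z.
  by have /opboundE[_ /(_ z)] := Sb n.
have cU n z : nrm (c%:C *: U n z) <= c * (c^-1 * M * q ^+ n) * nrm z.
  have /opboundE[_ /(_ z) h] := Ub n.
  by rewrite nrmZ gtr0_norm// -(mulrA c) ler_pM2l.
exists S; split=> // z; apply/eqP; rewrite -subr_eq0; apply/eqP.
  apply: (@nrm_le_geometric _ _ _ (B * nrm z + B * nrm (T' (T z)) +
    c * (c^-1 * M) * nrm z) _ q01) => n.
  have -> : S z + S (T' (T z)) - T z = (S z - s n z) +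
      (S (T' (T z)) - s n (T' (T z))) - c%:C *: U n z.
    by rewrite addrACA -opprD sl opprB addrA [RHS]addrAC addrK.
  rewrite (le_trans (nrmB _ _))// (le_trans (lerD (nrmD _ _) (cU n z)))//.
  rewrite (le_trans (lerD (lerD (St n z) (St n (T' (T z)))) (lexx _)))//.
  by rewrite le_eqVlt; apply/orP; left; apply/eqP; ring.
apply: (@nrm_le_geometric _ _ _ (B * nrm z + M * (M * (B * nrm z)) +
    c * (c^-1 * M) * nrm z) _ q01) => n.
have -> : S z + T (T' (S z)) - T z = (S z - s n z) +
    T (T' (S z - s n z)) - c%:C *: U n z.
  rewrite (linB _ _ lT') (linB _ _ lT).
  by rewrite addrACA -opprD sr opprB addrA [RHS]addrAC addrK.
have /opboundE[_ /(_ (T' (S z - s n z))) h1] := TM.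
have /opboundE[_ /(_ (S z - s n z)) h2] := TM'.
have h3 : nrm (T (T' (S z - s n z))) <= M * (M * (B * q ^+ n * nrm z)).
  by rewrite (le_trans h1)// ler_wpM2l// (le_trans h2)// ler_wpM2l.
rewrite (le_trans (nrmB _ _))// (le_trans (lerD (nrmD _ _) (cU n z)))//.
rewrite (le_trans (lerD (lerD (St n z) h3) (lexx _)))//.
by rewrite le_eqVlt; apply/orP; left; apply/eqP; ring.
Qed.

(** The operator 2 T (1 + T* T)^-1 of Kaplansky's density theorem: it moves x
   by what T x - y and T* y - x allow, because
   2 S x - T x = S (x - T* y) + S T* (y - T x) for S = T (1 + T* T)^-1, where
   |S| <= 1/2 and |S T*| <= 1. *)
Lemma kaplansky_contraction T T' (x y : H) : A T -> A T' -> adjoint dot T T' ->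
  exists S, [/\ A S, opbound S 1 &
    nrm (S x - y) <= nrm (T' y - x) / 2 + 2 * nrm (T x - y)].
Proof.
move=> AT AT' TT'; have [S [AS Sl Sr]] := regularized_exists AT AT' TT'.
have lS := alg_linear A_alg AS.
have [lT lT'] := (alg_linear A_alg AT, alg_linear A_alg AT').
have Sb z : nrm (S z) <= nrm z / 2.
  have : rdot (S z + T (T' (S z))) (S z) = rdot (T z) (S z) by rewrite Sr.
  rewrite rdotDl !(adjoint_rdot _ _ TT') -!(nrm_sqr dot_norm) => h.
  have := cauchy_schwarz dot_norm z (T' (S z)); rewrite -h.
  have := nrm_ge0 (S z); have := nrm_ge0 z.
  move: (nrm (S z)) (nrm z) (nrm (T' _)) => a d b d0 a0 h1.
  rewrite -(@ler_pXn2r _ 2)// ?nnegrE ?divr_ge0//.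
  have := sqr_ge0 (b - d / 2); have : (d / 2) ^+ 2 = d ^+ 2 / 4 by field.
  by rewrite sqrrB => -> ; nra.
have STb z : nrm (S (T' z)) <= nrm z.
  set s := S (T' z); have sE : s + T (T' s) = T (T' z) by rewrite /s Sr.
  have wE : T (T' (z - s)) = s.
    by rewrite (linB _ _ lT') (linB _ _ lT) -sE addrK.
  have zE : z = (z - s) + T (T' (z - s)) by rewrite wE subrK.
  have : nrm z ^+ 2 = nrm (z - s) ^+ 2 + 2 * nrm (T' (z - s)) ^+ 2 + nrm s ^+ 2.
    rewrite {1}zE (nrm_sqrD dot_norm) -(adjoint_rdot _ _ (adjoint_sym TT')) wE.
    by rewrite (nrm_sqr dot_norm (T' _)).
  move=> h; rewrite -(@ler_pXn2r _ 2)// ?nnegrE ?nrm_ge0// h.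
  have := sqr_ge0 (nrm (z - s)); have := sqr_ge0 (nrm (T' (z - s))); lra.
exists (2%:C *: S); split; first exact: alg_scale.
  apply/opboundE; split=> // z; rewrite nrmZ ger0_norm// mul1r.
  by have := Sb z; rewrite ler_pdivlMr// mulrC.
have two z : (2%:C *: S) z = S z + S z.
  by rewrite -[LHS]/(2%:C *: S z) (rmorphD _ 1 1) scalerDl !scale1r.
have TxE : T x - y = S x + S (T' (T x)) - y by rewrite Sl.
have -> : (2%:C *: S) x - y = (S (x - T' y) + S (T' (y - T x))) + (T x - y).
  rewrite TxE two (linB _ _ lT') !(linB _ _ lS) !addrA subrK.
  by rewrite (addrAC (S x) (- _) (S x)) subrK.
rewrite (le_trans (nrmD _ _))//.
have h1 := Sb (x - T' y); have h2 := STb (y - T x).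
have h3 := nrmD (S (x - T' y)) (S (T' (y - T x))).
rewrite nrmBC (nrmBC _ (T x)) in h1 h2.
lra.
Qed.

End Solve.

(** * A bipolar theorem for pairs of vectors *)

Section Bipolar.
Context {R : realType} {H : completeNormedModType R[i]}.
Variable dot : {dot H for (@Num.conj R[i])}.
Hypothesis dot_norm : induces_norm dot.
Local Notation rdot := (rdot dot).

(** The Hilbert space structure of H x H, whose product norm is the maximum. *)
Let rdot2 (p q : H * H) : R := rdot p.1 q.1 + rdot p.2 q.2.
Let nrm2 (p : H * H) : R := nrm p.1 ^+ 2 + nrm p.2 ^+ 2.

(** Minimise the distance from t to V. By the parallelogram law a minimising
   sequence converges, to l say, and by the variational inequality w = l - t is
   orthogonal to V, hence to its limit l; the hypothesis makes w orthogonal to t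
   as well, so w = 0. *)
Lemma bipolar_pair (V : set (H * H)) (t : H * H) :
  V !=set0 ->
  (forall (c : R) p q, V p -> V q -> V (c%:C *: p + q)) ->
  (forall w, (forall v, V v -> rdot v.1 w.1 + rdot v.2 w.2 = 0) ->
    rdot t.1 w.1 + rdot t.2 w.2 = 0) ->
  forall e : R, 0 < e ->
    exists2 v, V v & nrm (v.1 - t.1) <= e /\ nrm (v.2 - t.2) <= e.
Proof.
move=> V0 Vlin tV.
have nrm2D p q : nrm2 (p + q) = nrm2 p + 2 * rdot2 p q + nrm2 q.
  by rewrite /nrm2 /rdot2 !(nrm_sqrD dot_norm); ring.
have rdot2Zr (c : R) p q : rdot2 p (c%:C *: q) = c * rdot2 p q.
  by rewrite /rdot2 !rdotZr; ring.
have nrm2Z (c : R) p : nrm2 (c%:C *: p) = c ^+ 2 * nrm2 p.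
  by rewrite /nrm2 !nrmZ !exprMn !real_normK ?num_real//; ring.
have nrm2_ge0 p : 0 <= nrm2 p by rewrite addr_ge0// sqr_ge0.
have rdot2Dr p q r : rdot2 p (q + r) = rdot2 p q + rdot2 p r.
  by rewrite /rdot2 !rdotDr; ring.
have nrm_fst p (d : R) : 0 <= d -> nrm2 p <= d ^+ 2 -> nrm p.1 <= d.
  move=> d0 h; rewrite -(@ler_pXn2r _ 2)// ?nnegrE ?nrm_ge0//.
  by apply: le_trans h; rewrite lerDl sqr_ge0.
have nrm_snd p (d : R) : 0 <= d -> nrm2 p <= d ^+ 2 -> nrm p.2 <= d.
  move=> d0 h; rewrite -(@ler_pXn2r _ 2)// ?nnegrE ?nrm_ge0//.
  by apply: le_trans h; rewrite lerDr sqr_ge0.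
pose W := [set nrm2 (v - t) | v in V].
have infW : has_inf W.
  have [v Vv] := V0; split; first by exists (nrm2 (v - t)), v.
  by exists 0 => _ [u _ <-].
have Wle v : V v -> inf W <= nrm2 (v - t).
  by move=> Vv; apply: ge_inf; [exact: infW.2|exists v].
pose eps (n : nat) : R := (2^-1 ^+ n) ^+ 2.
have eps0 n : 0 < eps n by rewrite !exprn_gt0// invr_gt0.
have /choice[v vP] : forall n, exists v, V v /\ nrm2 (v - t) <= inf W + eps n.
  move=> n; have [_ [u Vu <-] /ltW ult] := inf_adherent (eps0 n) infW.
  by exists u.
have half01 : 0 <= (2^-1 : R) < 1 by apply/andP; split; lra.
(* The parallelogram law, for a + b, b and their midpoint. *)
have mid_gap a b (i e1 e2 : R) : nrm2 (a + b) <= i + e1 -> nrm2 b <= i + e2 ->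
    i <= nrm2 ((2^-1 : R)%:C *: a + b) -> nrm2 a <= 2 * (e1 + e2).
  rewrite !nrm2D nrm2Z.
  have -> : rdot2 ((2^-1 : R)%:C *: a) b = 2^-1 * rdot2 a b.
    by rewrite /rdot2 !rdotZl; ring.
  have -> : (2^-1 : R) ^+ 2 = 4^-1 by field.
  lra.
have para m n : nrm2 (v m - v n) <= 2 * (eps m + eps n).
  have [Vm hm] := vP m; have [Vn hn] := vP n.
  apply: (mid_gap _ (v n - t) (inf W)) => //; first by rewrite addrA subrK.
  rewrite addrA; apply: Wle; rewrite scalerBr -addrA; apply: (Vlin) => //.
  by rewrite -scaleNr -rmorphN; exact: Vlin.
have eps_small (d : R) : 0 < d -> exists N, forall n, (N <= n)%N -> 2^-1 ^+ n <= d.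
  move=> d0; have [N hN] := geometric_small 1 half01 d0.
  by exists N => n /hN; rewrite mul1r.
have cau (d : R) : 0 < d -> exists N, forall m n, (N <= m)%N -> (N <= n)%N ->
    nrm2 (v m - v n) <= d ^+ 2.
  move=> d0; have [|N hN] := eps_small (d / 2); first by rewrite divr_gt0.
  exists N => m n Nm Nn; rewrite (le_trans (para m n))//.
  have sq k : (N <= k)%N -> eps k <= (d / 2) ^+ 2.
    move=> /hN; rewrite /eps ler_pXn2r// nnegrE; last by rewrite divr_ge0// ltW.
    by rewrite exprn_ge0// invr_ge0.
  have := sq _ Nm; have := sq _ Nn.
  have -> : (d / 2) ^+ 2 = d ^+ 2 / 4 by field.
  lra.
have [|l1 l1P] := @nrm_complete _ _ (fun n => (v n).1).
  move=> d d0; have [N hN] := cau _ d0; exists N => m n Nm Nn.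
  exact: (nrm_fst (v m - v n) d (ltW d0) (hN _ _ Nm Nn)).
have [|l2 l2P] := @nrm_complete _ _ (fun n => (v n).2).
  move=> d d0; have [N hN] := cau _ d0; exists N => m n Nm Nn.
  exact: (nrm_snd (v m - v n) d (ltW d0) (hN _ _ Nm Nn)).
pose w : H * H := (l1 - t.1, l2 - t.2).
have lim (u : H * H) (d : R) : 0 < d -> exists N, forall n, (N <= n)%N ->
    `|rdot2 u (v n - t) - rdot2 u w| <= d.
  move=> d0; have C0 : 0 < nrm u.1 + nrm u.2 + 1.
    by rewrite ltr_wpDl// addr_ge0// nrm_ge0.
  have d1 : 0 < d / (nrm u.1 + nrm u.2 + 1) by rewrite divr_gt0.
  have [N1 h1] := l1P _ d1; have [N2 h2] := l2P _ d1.
  exists (maxn N1 N2) => n; rewrite geq_max => /andP[/h1 {}h1 /h2 {}h2].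
  have -> : rdot2 u (v n - t) - rdot2 u w =
      rdot u.1 ((v n).1 - l1) + rdot u.2 ((v n).2 - l2).
    by rewrite /rdot2 /= !rdotBr; ring.
  have cs := abs_cauchy_schwarz dot_norm.
  rewrite (le_trans (ler_normD _ _))// (le_trans (lerD (cs _ _) (cs _ _)))//.
  have g1 := ler_wpM2l (nrm_ge0 u.1) h1; have g2 := ler_wpM2l (nrm_ge0 u.2) h2.
  rewrite (le_trans (lerD g1 g2))// -mulrDl mulrA ler_pdivrMr// mulrC.
  by rewrite ler_pM2l// lerDl.
(* Moving v_n by c u cannot decrease the distance below the infimum; the choice
   c = q and c = - q, with q^2 the excess of v_n, bounds the inner product. *)
have wV u : V u -> rdot2 u w = 0.
  move=> Vu; apply: abs_small => d d0.
  have d2 : 0 < d / 2 by rewrite divr_gt0.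
  have [N hN] := lim u _ d2.
  have k1 : 0 < nrm2 u + 1 by rewrite ltr_wpDl.
  have [|M hM] := eps_small (d / 2 / (nrm2 u + 1)); first by rewrite divr_gt0.
  have {hN} := hN _ (leq_maxl N M); have {hM} := hM _ (leq_maxr N M).
  set n := maxn N M; have [Vn hn] := vP n; set q := 2^-1 ^+ n => hq hlim.
  have q0 : 0 < q by rewrite exprn_gt0// invr_gt0.
  have var (c : R) : 0 <= q ^+ 2 + 2 * c * rdot2 u (v n - t) + c ^+ 2 * nrm2 u.
    have := Wle _ (Vlin c u (v n) Vu Vn); rewrite -addrA nrm2D nrm2Z.
    have -> : rdot2 (c%:C *: u) (v n - t) = c * rdot2 u (v n - t).
      by rewrite /rdot2 !rdotZl; ring.
    by move: hn; rewrite /eps -/q; lra.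
  have small : `|rdot2 u (v n - t)| <= d / 2.
    apply: (@le_trans _ _ (q * (nrm2 u + 1))); last by rewrite -ler_pdivlMr.
    have hp := var q; have hm := var (- q).
    have q2 : 0 < 2 * q by rewrite mulr_gt0.
    have n0 := nrm2_ge0 u.
    rewrite ler_norml; apply/andP; split; nra.
  have := ler_normD (rdot2 u w - rdot2 u (v n - t)) (rdot2 u (v n - t)).
  by rewrite subrK distrC; lra.
have tw := tV w wV.
have w0 : nrm2 w = 0.
  have tw' : rdot2 t w = 0 by exact: tw.
  have -> : nrm2 w = rdot2 w w by rewrite /nrm2 /rdot2 !(nrm_sqr dot_norm).
  apply: abs_small => d d0.
  have [N hN] := lim w _ d0; have {hN} := hN _ (leqnn N).
  have -> : rdot2 w (v N - t) = 0.
    have [VN _] := vP N; have := wV _ VN; move: tw'.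
    rewrite /rdot2 /= !rdotBr !(rdotC _ (l1 - t.1)) !(rdotC _ (l2 - t.2)).
    lra.
  by rewrite sub0r normrN.
move=> e e0; have [N1 h1] := l1P _ e0; have [N2 h2] := l2P _ e0.
have [w1 w2] : l1 = t.1 /\ l2 = t.2.
  have := nrm2_ge0 w; have s1 := sqr_ge0 (nrm w.1); have s2 := sqr_ge0 (nrm w.2).
  have z1 : nrm w.1 ^+ 2 = 0 by move: w0; rewrite /nrm2; lra.
  have z2 : nrm w.2 ^+ 2 = 0 by move: w0; rewrite /nrm2; lra.
  move/eqP: z1; rewrite sqrf_eq0 => /eqP/nrm_eq0/eqP; rewrite subr_eq0 => /eqP.
  move/eqP: z2; rewrite sqrf_eq0 => /eqP/nrm_eq0/eqP; rewrite subr_eq0 => /eqP.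
  by [].
exists (v (maxn N1 N2)); first by have [] := vP (maxn N1 N2).
by rewrite -w1 -w2; split; [apply: h1; exact: leq_maxl|apply: h2; exact: leq_maxr].
Qed.

End Bipolar.

(** * Kadison transitivity in the corner of an atom *)

Section Wot.
Context {R : realType} {H : completeNormedModType R[i]}.
Variable dot : {dot H for (@Num.conj R[i])}.
Hypothesis dot_norm : induces_norm dot.
Local Notation rdot := (rdot dot).
Local Notation oproj := (orthogonal_projection dot).
Variable L : set (H -> H).
Hypothesis L_csl : csl dot L.
Variable A : set (H -> H).
Hypothesis A_alg : operator_algebra A.
Hypothesis A_dense : wot_closure dot A = alg L.
Implicit Types (x y z : H) (E G P T : H -> H).

(** Only this much of the weak operator topology is used: finite sums of matrix
   coefficients are continuous for it. *)
Lemma wot_annihilator u1 v1 u2 v2 :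
  (forall T, A T -> dot (T u1) v1 + dot (T u2) v2 = 0) ->
  forall T, alg L T -> dot (T u1) v1 + dot (T u2) v2 = 0.
Proof.
move=> hA T; rewrite -A_dense => -[cT _].
pose W := initial_topology (matrix_coefficients dot).
pose phi (S : W) : R[i]^o := dot (S u1) v1 + dot (S u2) v2.
have ev u v : continuous (fun S : W => dot (S u) v : R[i]^o).
  move=> S.
  apply: (@cvg_comp W {ptws (H * H)%type -> R[i]^o} R[i]^o
    (matrix_coefficients dot) (fun f => f (u, v)) (nbhs S)
    (nbhs (matrix_coefficients dot S : {ptws (H * H)%type -> R[i]^o}))).
    exact: initial_continuous.
  exact: (@proj_continuous _ (fun=> R[i]^o) (u, v)).
have cphi : continuous phi.
  move=> S; exact: (cvgD (ev u1 v1 S) (ev u2 v2 S)).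
have cl : closed (phi @^-1` [set 0]).
  move/continuous_closedP : cphi; apply.
  exact/accessible_closed_set1/hausdorff_accessible/norm_hausdorff.
by apply: cl; apply: closure_subset cT => S /hA.
Qed.

(** For an atom G, this says that G lies below the hull of E. *)
Definition dominates E G := forall P, L P ->
  (forall z, P (E z) = E z) -> forall z, P (G z) = G z.

(** On the range of a P in L that contains E, the operator takes values in G <= P;
   on the range of any other P it vanishes, E being an atom. *)
Lemma rank_one_alg E G x y : atom L E -> atom L G -> dominates E G ->
  E x = x -> G y = y -> alg L (fun z => dot z x *: y).
Proof.
move=> aE aG EG Ex Gy; split.
  split; first by move=> a u v; rewrite linearDl linearZl_LR scalerDl scalerA.
  exists (2 * nrm x * nrm y); apply/opboundE.
  split=> [|z]; first by rewrite !mulr_ge0 ?nrm_ge0.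
  have cs := abs_cauchy_schwarz dot_norm.
  have zE : dot z x = (rdot z x)%:C + (rdot ((- 'i%C) *: z) x)%:C * 'i%C.
    rewrite /rdot linearZl_LR /=; case: (dot z x) => a b /=.
    by apply/eqP; rewrite eq_complex /=; apply/andP; split; apply/eqP; ring.
  have hr (c : R) : nrm (c%:C *: y) = `|c| * nrm y by exact: nrmZ.
  have ni u : nrm ('i%C *: u) = nrm u.
    by rewrite /nrm normrZ normc_def /= expr0n/= expr1n add0r sqrtr1 mul1r.
  rewrite zE scalerDl (mulrC _ 'i%C) -scalerA (le_trans (nrmD _ _))//.
  rewrite ni !hr; have h1 := cs z x; have := cs ((- 'i%C) *: z) x.
  rewrite scaleNr nrmN ni -scaleNr => h2.
  rewrite -mulrDl mulrAC ler_wpM2r ?nrm_ge0// mulrAC -mulrA mulr2n mulrDl mul1r.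
  by rewrite mulrC lerD// mulrC.
move=> P LP _ [_ [z _ <-] <-].
have linP := L_linear L_csl LP.
have [PE|PE] := atom_dichotomy dot_norm L_csl aE LP.
  exists (dot (P z) x *: y) => //; rewrite (linZ _ _ linP).
  by rewrite -{1}Gy (EG _ LP PE) Gy.
exists 0 => //; rewrite (lin0 linP).
have oP := L_oproj L_csl LP.
have -> : dot (P z) x = dot z (P x) by case: oP => _ _ ->.
by rewrite -Ex PE linear0r scale0r.
Qed.

Lemma compression_absorb E G S z : oproj E -> oproj G ->
  compression G A E S -> G (S z) = S z /\ S (E z) = S z.
Proof.
move=> oE oG [T AT <-] /=.
by rewrite (oprojK _ oE) (oprojK _ oG).
Qed.

(** Successive approximation reduces to matching y up to |y| / 2 by a bounded
   element of the corner; after scaling y to the norm of x, a contraction does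
   it. *)
Lemma kadison E x y : atom L E -> cstar_algebra dot (compression E A E) ->
  E x = x -> E y = y -> x <> 0 ->
  exists S, [/\ compression E A E S, opbound S (2 * (nrm x)^-1 * nrm y) &
    S x = y].
Proof.
move=> aE [B_alg B_closed B_star] Ex Ey x0.
have oE := atom_oproj dot_norm L_csl aE; have linE := oproj_linear oE.
have r0 := nrm_gt0 x0; set r := nrm x in r0 *.
have ri0 : 0 <= r^-1 by rewrite invr_ge0 ltW.
apply: (solve_by_halving B_alg B_closed (Y := [set y | E y = y]) ri0) => // {y Ey}.
move=> y /= Ey; have [->|/eqP y0] := eqVneq y 0.
  exists 0; rewrite nrm0 !subrr mulr0 mul0r (lin0 linE) nrm0.
  split=> //; first exact: alg0.
  by apply/opboundE; split=> // z; rewrite nrm0 mul0r.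
have p0 := nrm_gt0 y0; pose y' := (r / nrm y)%:C *: y.
have y'E : nrm y' = r.
  by rewrite nrmZ ger0_norm ?divr_ge0 ?nrm_ge0// mulfVK// gt_eqF.
have Ey' : E y' = y' by rewrite (linZ _ _ linE) Ey.
have yE : y = (nrm y / r)%:C *: y'.
  rewrite scalerA -rmorphM mulrA mulfVK ?gt_eqF// mulfV ?gt_eqF//.
  by rewrite scale1r.
clearbody y'.
have yr0 : 0 <= nrm y / r by rewrite divr_ge0 ?nrm_ge0// ltW.
have dominE : dominates E E by [].
(* Some T in the corner has T x close to y' and T* y' close to x: a pair (w1, w2)
   orthogonal to all (T x, T* y') defines a functional vanishing on the corner,
   hence on the rank one operator z |-> <z, x> y', which sends x to a multiple of
   y' and whose adjoint sends y' to the same multiple of x. The tolerance r / 8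
   makes the error of the contraction at most r / 2. *)
pose V := [set p : H * H | exists T T', [/\ compression E A E T,
  compression E A E T', adjoint dot T T' & p = (T x, T' y')]].
have [_ [T [T' [BT BT' TT' ->]]] /= [hT hT']] : exists2 v, V v &
    nrm (v.1 - y') <= r / 8 /\ nrm (v.2 - x) <= r / 8.
  apply: (bipolar_pair dot_norm (t := (y', x))); last by rewrite divr_gt0.
  - exists (0, 0), 0, 0; split=> //; try exact: alg0.
    by move=> u w; rewrite linear0l linear0r.
  - move=> c _ _ [T1 [T1' [B1 B1' a1 ->]]] [T2 [T2' [B2 B2' a2 ->]]].
    exists (c%:C *: T1 + T2), (c%:C *: T1' + T2').
    split=> //; try exact: alg_lincomb.
    apply: (rdot_adjoint); first by apply: (alg_linear B_alg); exact: alg_lincomb.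
    move=> u w; rewrite -[(_ + T2) u]/(c%:C *: T1 u + T2 u).
    rewrite -[(_ + T2') w]/(c%:C *: T1' w + T2' w) !rdotE.
    by rewrite (adjoint_rdot _ _ a1) (adjoint_rdot _ _ a2).
  - move=> [w1 w2] /= hw.
    have re0 T : compression E A E T ->
        complex.Re (dot (T x) w1 + dot (T w2) y') = 0.
      move=> BT; have [T' BT' TT'] := B_star T BT.
      have := hw _ (ex_intro _ T (ex_intro _ T' (And4 BT BT' TT' erefl))) => /= <-.
      rewrite raddfD /= -/(rdot _ _) -/(rdot _ _).
      by rewrite (adjoint_rdot w2 _ TT') (rdotC _ w2).
    have all0 T : compression E A E T -> dot (T x) w1 + dot (T w2) y' = 0.
      move=> BT; have h1 := re0 _ BT.
      have := re0 _ (alg_scale B_alg 'i%C BT).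
      rewrite -[('i%C *: T) x]/('i%C *: T x) -[('i%C *: T) w2]/('i%C *: T w2).
      rewrite !linearZl_LR -mulrDr /=.
      move: h1; case: (_ + _) => a b /= -> h2; apply/eqP; rewrite eq_complex /=.
      move: h2; rewrite eqxx mul0r mul1r sub0r => /eqP.
      by rewrite oppr_eq0.
    have aEE u w : dot (E u) w = dot u (E w) by case: oE => _ _; exact.
    have annA T : A T -> dot (T x) (E w1) + dot (T (E w2)) y' = 0.
      move=> AT; have := all0 _ (ex_intro2 _ _ T AT erefl).
      by rewrite /= !aEE Ex Ey'.
    have := wot_annihilator annA (rank_one_alg aE aE dominE Ex Ey').
    have dxx : dot x x = (r ^+ 2)%:C by rewrite -dot_norm nrmE rmorphXn.
    have dyy : dot y' y' = (r ^+ 2)%:C by rewrite -dot_norm nrmE y'E rmorphXn.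
    rewrite !linearZl_LR /= dxx dyy -(aEE y') Ey' (aEE w2) Ex.
    rewrite (mulrC (dot w2 x)) -mulrDr => /eqP; rewrite mulf_eq0 => /orP[|].
      by rewrite (inj_eq (@complexI R) _ 0) sqrf_eq0 gt_eqF.
    by move=> /eqP/(congr1 (@complex.Re R)); rewrite raddfD (rdotC _ x).
have [S [BS Sb hS]] := kaplansky_contraction B_alg B_closed dot_norm x y' BT BT' TT'.
exists ((nrm y / r)%:C *: S); split.
- exact: alg_scale.
- have := opbound_scale (nrm y / r) Sb.
  by rewrite mulr1 (ger0_norm yr0) mulrC.
- have BSr : compression E A E ((nrm y / r)%:C *: S) by exact: alg_scale.
  have [ES _] := compression_absorb x oE oE BSr.
  by rewrite (linB _ _ linE) Ey ES.
- rewrite -[(_ *: S) x]/((nrm y / r)%:C *: S x) {1}yE -scalerBr nrmZ.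
  rewrite (ger0_norm yr0) nrmBC.
  rewrite -mulrA ler_pM2l// mulrC ler_pdivrMr// mulrC.
  by move: hS hT hT'; lra.
Qed.

End Wot.

(** * Atoms and vectors *)

Section NearNorming.
Context {R : realType} {H : completeNormedModType R[i]}.

(** If no vector attains half of some bound, every bound can be halved, again and
   again, and T vanishes. *)
Lemma near_norming_vector (T : H -> H) (M0 : R) (u0 : H) :
  opbound T M0 -> T u0 <> 0 ->
  exists v M, [/\ opbound T M, T v <> 0 & M * nrm v <= 2 * nrm (T v)].
Proof.
move=> TM0 Tu0; apply: contrapT => none.
have halve (M : R) : opbound T M -> opbound T (M / 2).
  move=> TM; apply/opboundE; split=> [|v].
    by have [M0' _] := TM; rewrite divr_ge0.
  have [->|Tv] := pselect (T v = 0).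
    by rewrite nrm0 mulr_ge0 ?nrm_ge0// divr_ge0//; case: TM.
  rewrite leNgt; apply/negP => h; apply: none; exists v, M; split=> //.
  by move: h; lra.
have TM n : opbound T (M0 * 2^-1 ^+ n).
  elim: n => [|n /halve]; first by rewrite mulr1.
  by rewrite exprSr mulrA.
apply: Tu0; apply: (@nrm_le_geometric _ _ _ (M0 * nrm u0) 2^-1).
  by apply/andP; split; lra.
by move=> n; have /opboundE[_ /(_ u0)] := TM n; rewrite mulrAC.
Qed.

End NearNorming.

Section Hyperatomic.
Context {R : realType} {H : completeNormedModType R[i]}.
Variable dot : {dot H for (@Num.conj R[i])}.
Hypothesis dot_norm : induces_norm dot.
Local Notation rdot := (rdot dot).
Local Notation oproj := (orthogonal_projection dot).
Variable L : set (H -> H).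
Hypothesis L_csl : csl dot L.
Implicit Types (x y z : H) (E F G P Q T U : H -> H) (S M N : set H).
Let aO E (aE : atom L E) : oproj E := atom_oproj dot_norm L_csl aE.
Let aL E (aE : atom L E) : linear E := atom_linear dot_norm L_csl aE.

(** The atoms of the list bad are examined in turn. Suppose that A = U - F, with U
   the hull of A, vanishes on S, and that Q lies above all the other atoms. The
   vectors of S lie in the join of U and Q and are killed by A = U - F, so they
   lie in the join of F and Q; by minimality so does P, and with it A. As A is
   orthogonal to F, it cannot be orthogonal to Q, so A lies below Q too. *)
Lemma discard_vanishing_atoms S P (bad good : seq (H -> H)) :
  smallest_over L S P ->
  (forall A, (A \in good) || (A \in bad) -> atom L A /\ proj_le A P) ->
  (forall A, A \in good -> exists2 x, S x & A x <> 0) ->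
  (forall Q, L Q -> (forall A, (A \in good) || (A \in bad) -> proj_le A Q) ->
    proj_le P Q) ->
  exists s : seq (H -> H),
    (forall A, A \in s -> atom L A /\ exists2 x, S x & A x <> 0) /\
    (forall Q, L Q -> (forall A, A \in s -> proj_le A Q) -> proj_le P Q).
Proof.
move=> [LP SP minP]; elim: bad good => [|A bad IH] good atoms goodS hull.
  exists good; split=> [A gA|Q LQ h].
    by split; [have [] := atoms A (introT orP (or_introl gA))|exact: goodS].
  by apply: hull => // A /orP[/h|].
have [aA AP] : atom L A /\ proj_le A P by apply: atoms; rewrite mem_head orbT.
have [|vanish] := pselect (exists2 x, S x & A x <> 0).
  move=> AS; apply: (IH (A :: good)) => [B|B|Q LQ h].
  - rewrite inE => h; apply: atoms; rewrite inE; move: h.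
    by case: (B == A); rewrite ?orbT.
  - by rewrite inE => /orP[/eqP->|]; [|exact: goodS].
  - apply: hull => // B h'; apply: h; move: h'; rewrite !inE.
    by case: (B == A); rewrite ?orbT.
have A0 x : S x -> A x = 0.
  by move=> Sx; apply: contrapT => Ax; apply: vanish; exists x.
apply: (IH good) => // [B h|Q LQ h].
  by apply: atoms; rewrite inE; move: h; case: (B == A); rewrite ?orbT.
suff AQ : proj_le A Q.
  apply: hull => // B; rewrite inE => /or3P[gB|/eqP->//|bB]; apply: h.
    by rewrite gB.
  by rewrite bB orbT.
have [U [F [[LU AU _] LF FU AE]]] := atom_hull dot_norm L_csl aA.
have [oU oF] := (L_oproj L_csl LU, L_oproj L_csl LF).
have oQ := L_oproj L_csl LQ.
have Az z : A z = U z - F z by rewrite AE.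
apply/(proj_leP _ oQ).
have [//|QA] := atom_dichotomy dot_norm L_csl aA LQ.
exfalso; have [x0] := atom_neq0 aA; apply.
have LJ := L_join dot_norm L_csl LU LQ; have oJ := L_oproj L_csl LJ.
have PJ : proj_le P (proj_join U Q).
  apply: hull => // B; rewrite inE => hB; apply/(proj_leP _ oJ) => z.
  have [BU|BQ] : proj_le B U \/ proj_le B Q.
    move: hB => /or3P[gB|/eqP->|bB]; [right|left|right] => //; apply: h.
      by rewrite gB.
    by rewrite bB orbT.
  - rewrite proj_joinE (L_comm L_csl _ LU LQ) ((proj_leP _ oU).1 BU).
    by rewrite addrK.
  - by rewrite proj_joinE ((proj_leP _ oQ).1 BQ) addrAC subrr add0r.
have LK := L_join dot_norm L_csl LF LQ; have oK := L_oproj L_csl LK.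
have PK : proj_le P (proj_join F Q).
  apply: minP => // x Sx; apply/(range_oproj _ oK).
  have Px : proj_join U Q x = x by apply/(range_oproj _ oJ)/PJ/SP.
  have UF : U x = F x by apply/eqP; rewrite -subr_eq0 -Az A0.
  rewrite -[RHS]Px !proj_joinE (L_comm L_csl _ LU LQ) UF.
  by rewrite -(L_comm L_csl _ LF LQ).
have AK := (proj_leP _ oK).1 (proj_le_trans AP PK) x0.
rewrite -AK proj_joinE QA (lin0 (L_linear L_csl LF)) Az.
rewrite (linB _ _ (L_linear L_csl LF)).
by rewrite (proj_le_absorb dot_norm _ oF oU FU) (oprojK _ oF) subrr addr0 subrr.
Qed.

Hypothesis L_hyperatomic : hyperatomic L.

Lemma nonvanishing_atoms S P : smallest_over L S P ->
  exists s : seq (H -> H),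
    (forall A, A \in s -> atom L A /\ exists2 x, S x & A x <> 0) /\
    (forall Q, L Q -> (forall A, A \in s -> proj_le A Q) -> proj_le P Q).
Proof.
move=> SP; have [LP _ _] := SP.
have [P0|/(L_hyperatomic LP)[k [A [aA [_ AP minP]]]]] := pselect (P = 0).
  exists [::]; split=> // Q LQ _ _ [x _ <-]; rewrite P0.
  by exists 0 => //; rewrite (lin0 (L_linear L_csl LQ)).
apply: (@discard_vanishing_atoms S P [seq A i | i : 'I_k] [::] SP) => // [B|Q LQ h].
  by rewrite in_nil /= => /mapP[i _ ->].
apply: minP => // i; apply: h; apply/orP; right.
by apply/mapP; exists i; rewrite ?mem_enum.
Qed.

(** The smallest projection over {z} is the hull of atoms that do not vanish at
   z, hence of no atom at all. *)
Lemma atoms_total z : (forall G, atom L G -> G z = 0) -> z = 0.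
Proof.
move=> h; have [P SP] := smallest_over_exists dot_norm L_csl [set z].
have [s [sS minP]] := nonvanishing_atoms SP.
have [_ /(_ z erefl) zP _] := SP.
have : proj_le P 0.
  apply: minP; first exact: csl_bot L_csl.
  by move=> G /sS[aG [_ -> []]]; exact: h.
by move=> /(_ _ zP)[].
Qed.

Definition off_atoms (s : seq (H -> H)) : H -> H := id - \sum_(G <- s) G.

Lemma off_atomsE s z : off_atoms s z = z - \sum_(G <- s) G z.
Proof. by rewrite -[LHS]/(z - (\sum_(G <- s) G) z) fct_sumE. Qed.

Lemma sum_atoms_off s G (w : (H -> H) -> H) :
  (forall B, B \in s -> atom L B) -> atom L G ->
  G \notin s -> G (\sum_(B <- s) B (w B)) = 0.
Proof.
move=> + aG; elim: s => [|B s IH] hs; first by rewrite big_nil (lin0 (aL aG)).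
rewrite inE negb_or => /andP[GB Gs]; rewrite big_cons (linD _ _ (aL aG)).
rewrite IH//.
  have aB : atom L B by apply: hs; rewrite mem_head.
  rewrite (atom_ortho dot_norm L_csl (w B) aB aG) ?addr0//.
  by apply/eqP; rewrite eq_sym.
by move=> C Cs; apply: hs; rewrite inE Cs orbT.
Qed.

Lemma sum_atoms_in s G (w : (H -> H) -> H) :
  (forall B, B \in s -> atom L B) -> uniq s ->
  G \in s -> G (\sum_(B <- s) B (w B)) = G (w G).
Proof.
elim: s => [//|B s IH] hs /andP[Bs us].
have aB : atom L B by apply: hs; rewrite mem_head.
have hs' C : C \in s -> atom L C by move=> Cs; apply: hs; rewrite inE Cs orbT.
rewrite inE => /predU1P[->|Gs]; rewrite big_cons.
  by rewrite (linD _ _ (aL aB)) sum_atoms_off// addr0 (oprojK _ (aO aB)).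
have aG := hs' _ Gs; rewrite (linD _ _ (aL aG)) IH//.
rewrite (atom_ortho dot_norm L_csl _ aB aG) ?add0r// => BG.
by rewrite BG Gs in Bs.
Qed.

Lemma off_atoms_kill s G z : (forall B, B \in s -> atom L B) -> uniq s ->
  G \in s -> G (off_atoms s z) = 0.
Proof.
move=> hs us Gs; rewrite off_atomsE (linB _ _ (aL (hs _ Gs))).
by rewrite (sum_atoms_in (fun=> z))// subrr.
Qed.

Lemma off_atoms_fix s z : (forall B, B \in s -> B z = 0) -> off_atoms s z = z.
Proof. by move=> h; rewrite off_atomsE big1_seq ?subr0// => B /andP[_ /h]. Qed.

Lemma off_atoms_oproj s : (forall B, B \in s -> atom L B) -> uniq s ->
  oproj (off_atoms s).
Proof.
move=> hs us; apply: (oprojI dot_norm) => [||x y].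
- apply: linear_sub; first exact: linear_id.
  elim: s hs {us} => [|B s IH] hs; first by rewrite big_nil; exact: linear_cst0.
  rewrite big_cons; apply: linear_add; first by apply/aL/hs; rewrite mem_head.
  by apply: IH => C Cs; apply: hs; rewrite inE Cs orbT.
- by move=> x; apply: off_atoms_fix => B Bs; exact: off_atoms_kill.
- rewrite !off_atomsE !rdotE; congr (_ - _).
  elim: s hs {us} => [|B s IH] hs; first by rewrite !big_nil rdot0l rdot0r.
  rewrite !big_cons !rdotE (oproj_rdot _ _ (aO (hs _ (mem_head _ _)))) IH//.
  by move=> C Cs; apply: hs; rewrite inE Cs orbT.
Qed.

(** The projections off finitely many atoms decrease to a projection killed by
   every atom, which is zero. *)
Lemma atoms_approx z (e : R) : 0 < e -> exists s : seq (H -> H),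
  [/\ forall B, B \in s -> atom L B, uniq s & nrm (off_atoms s z) <= e].
Proof.
move=> e0; pose D := [set off_atoms s | s in
  [set s : seq (H -> H) | (forall B, B \in s -> atom L B) /\ uniq s]].
have [|||P [oP _ PD apx]] := @directed_inf _ _ _ dot_norm D.
- by move=> _ [s [hs us] <-]; exact: off_atoms_oproj.
- by exists (off_atoms [::]), [::].
- move=> _ _ [s [hs us] <-] [t [ht ut] <-].
  have hu B : B \in undup (s ++ t) -> atom L B.
    by rewrite mem_undup mem_cat => /orP[/hs|/ht].
  exists (off_atoms (undup (s ++ t))); split.
  + by exists (undup (s ++ t)) => //; split=> //; exact: undup_uniq.
  + apply/(proj_leP _ (off_atoms_oproj hs us)) => w; apply: off_atoms_fix => B Bs.
    by apply: off_atoms_kill => //; rewrite ?undup_uniq// mem_undup mem_cat Bs.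
  + apply/(proj_leP _ (off_atoms_oproj ht ut)) => w; apply: off_atoms_fix => B Bs.
    by apply: off_atoms_kill => //; rewrite ?undup_uniq// mem_undup mem_cat Bs orbT.
have Pz : P z = 0.
  apply: atoms_total => G aG.
  have hG B : B \in [:: G] -> atom L B by rewrite inE => /eqP->.
  have DG : D (off_atoms [:: G]) by exists [:: G].
  have := (proj_leP _ (off_atoms_oproj hG isT)).1 (PD _ DG) z => <-.
  by apply: off_atoms_kill => //; rewrite mem_head.
have [_ [s [hs us] <-]] := apx z e e0.
by rewrite Pz subr0; exists s.
Qed.

(** Bessel's inequality. *)
Lemma atoms_energy s y : (forall B, B \in s -> atom L B) -> uniq s ->
  \sum_(B <- s) nrm (B y) ^+ 2 <= nrm y ^+ 2.
Proof.
move=> hs us; have oS := off_atoms_oproj hs us.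
have -> : \sum_(B <- s) nrm (B y) ^+ 2 = nrm y ^+ 2 - nrm (off_atoms s y) ^+ 2.
  rewrite (nrm_sqr dot_norm (off_atoms s y)) (oproj_rdot _ _ oS) (oprojK _ oS).
  rewrite off_atomsE rdotBr (nrm_sqr dot_norm y) opprB addrC subrK.
  elim: s hs {us oS} => [|B s IH] hs; first by rewrite !big_nil rdot0r.
  rewrite !big_cons rdotDr -IH; last by move=> C Cs; apply: hs; rewrite inE Cs orbT.
  have oB := aO (hs _ (mem_head B s)).
  by rewrite (nrm_sqr dot_norm) (oproj_rdot _ _ oB) (oprojK _ oB).
by rewrite gerBl sqr_ge0.
Qed.

End Hyperatomic.

(** * Orbits and invariant manifolds *)

Section Orbits.
Context {R : realType} {H : completeNormedModType R[i]}.
Variable dot : {dot H for (@Num.conj R[i])}.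
Hypothesis dot_norm : induces_norm dot.
Local Notation rdot := (rdot dot).
Local Notation oproj := (orthogonal_projection dot).
Variable L : set (H -> H).
Hypothesis L_csl : csl dot L.
Hypothesis L_hyperatomic : hyperatomic L.
Variable A : set (H -> H).
Hypothesis A_alg : operator_algebra A.
Hypothesis A_sub : A `<=` alg L.
Hypothesis A_closed : norm_closed A.
Hypothesis A_dense : wot_closure dot A = alg L.
Hypothesis A_atoms :
  forall E F, atom L E -> atom L F -> compression E A F `<=` A.
Hypothesis A_cstar :
  forall E, atom L E -> cstar_algebra dot (compression E A E).
Implicit Types (x y z : H) (E F G P Q T U : H -> H) (S M N : set H).
Local Notation orbit := Defs.orbit.
Let aO E (aE : atom L E) : oproj E := atom_oproj dot_norm L_csl aE.
Let aL E (aE : atom L E) : linear E := atom_linear dot_norm L_csl aE.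

(** Transitivity from an atom E to a dominated atom G: any nonzero operator of
   G A E is composed with the Kadison operators of both corners. Choosing a
   vector at which it attains half of some bound keeps the estimate independent
   of G; each of the three factors contributes a 2 to the constant 8. *)
Lemma dominated_transitive E G x y : atom L E -> atom L G -> dominates L E G ->
  E x <> 0 -> G y = y ->
  exists T, [/\ A T, opbound T (8 / nrm (E x) * nrm y), T x = y &
    forall z, G (T z) = T z].
Proof.
move=> aE aG EG Ex0 Gy.
have [oE oG] := (aO aE, aO aG); have [lE lG] := (aL aE, aL aG).
have [T AT [u0 GTE0]] : exists2 T, A T & exists u, G (T (E u)) <> 0.
  apply: contrapT => none; have [v0 Gv0] := atom_neq0 aG.
  have ann T : A T -> dot (T (E x)) (G v0) + dot (T 0) 0 = 0.
    move=> AT; rewrite linear0r addr0.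
    have <- : dot (G (T (E x))) v0 = dot (T (E x)) (G v0) by case: oG => _ _ ->.
    have -> : G (T (E x)) = 0; last by rewrite linear0l.
    by apply: contrapT => h; apply: none; exists T => //; exists x.
  have := wot_annihilator A_dense ann
    (rank_one_alg dot_norm L_csl aE aG EG (oprojK x oE) (oprojK v0 oG)).
  rewrite linear0r addr0 linearZl_LR /= -!dot_norm => /eqP.
  by rewrite mulf_eq0 !expf_eq0 /= !normr_eq0 => /orP[/eqP|/eqP].
pose S0 := G \o T \o E.
have AS0 : compression G A E S0 by exists T.
have [M0 S0M] := alg_bounded A_alg (A_atoms aG aE AS0).
have [v [M [SM Sv vM]]] := near_norming_vector S0M (GTE0 : S0 u0 <> 0).
pose u := E v.
have Su : S0 u = S0 v by rewrite /S0 /u /= (oprojK _ oE).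
have uv : nrm u <= nrm v by exact: oproj_nrm_le.
have [K1 [BK1 K1b K1x]] := kadison dot_norm L_csl A_dense aE (A_cstar aE)
  (oprojK x oE) (oprojK v oE) Ex0.
have GSv : G (S0 v) = S0 v by rewrite /S0 /= (oprojK _ oG).
have [K2 [BK2 K2b K2v]] := kadison dot_norm L_csl A_dense aG (A_cstar aG)
  GSv Gy Sv.
exists (K2 \o S0 \o K1); split.
- apply: (alg_comp A_alg); last exact: A_atoms BK1.
  by apply: (alg_comp A_alg); [exact: A_atoms BK2|exact: A_atoms AS0].
- apply: opbound_le (opbound_comp (opbound_comp K2b SM) K1b) _.
  have M00 : 0 <= M by case: SM.
  have p1 := nrm_gt0 Sv; have p2 := nrm_gt0 Ex0.
  have h : M * nrm u <= 2 * nrm (S0 v).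
    by apply: le_trans vM; rewrite ler_wpM2l.
  have -> : 2 / nrm (S0 v) * nrm y * M * (2 / nrm (E x) * nrm (E v)) =
      (4 / nrm (E x) * nrm y) * (M * nrm u / nrm (S0 v)) by rewrite /u; ring.
  have -> : 8 / nrm (E x) * nrm y = (4 / nrm (E x) * nrm y) * 2 by ring.
  apply: ler_wpM2l; last by rewrite ler_pdivrMr.
  by rewrite mulr_ge0 ?nrm_ge0// divr_ge0// nrm_ge0.
- have [_ K1E] := compression_absorb x oE oE BK1.
  by rewrite /= -K1E K1x Su.
- by move=> z; have [] := compression_absorb (S0 (K1 z)) oG oG BK2.
Qed.

(** Since the ranges of distinct atoms are orthogonal, the squared norms of the
   pieces add up, so the bound does not depend on the number of atoms. *)
Lemma finite_sum_in_orbit E U x y (s : seq (H -> H)) :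
  atom L E -> smallest_over L (range E) U -> E x <> 0 -> U y = y ->
  (forall B, B \in s -> atom L B) -> uniq s ->
  exists T, [/\ A T, T x = \sum_(B <- s) B y,
    forall z, nrm (T z) ^+ 2 <=
      (8 / nrm (E x) * nrm z) ^+ 2 * \sum_(B <- s) nrm (B y) ^+ 2 &
    forall G z, atom L G -> G \notin s -> G (T z) = 0].
Proof.
move=> aE [LU EU minU] Ex0 Uy; elim: s => [|G s IH] hs.
  move=> _; exists 0; split; first exact: (alg0 A_alg).
  - by rewrite big_nil.
  - by move=> z; rewrite big_nil mulr0 nrm0 expr0n.
  - by move=> G z aG _; exact: lin0 (aL aG).
move=> /andP[Gs us].
have [|T [AT Tx Tb Toff]] := IH _ us.
  by move=> C Cs; apply: hs; rewrite inE Cs orbT.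
have aG : atom L G by apply: hs; rewrite mem_head.
have [oG lG] := (aO aG, aL aG).
have [T1 [AT1 T1b T1x T1G]] : exists T1, [/\ A T1,
    opbound T1 (8 / nrm (E x) * nrm (G y)), T1 x = G y &
    forall z, G (T1 z) = T1 z].
  have [UG|UG] := atom_dichotomy dot_norm L_csl aG LU.
    apply: (dominated_transitive aE aG _ Ex0 (oprojK y oG)).
    move=> P LP PE z; rewrite -UG.
    apply/((proj_leP _ (L_oproj L_csl LP)).1)/minU => // _ [w _ <-].
    by apply/(range_oproj _ (L_oproj L_csl LP)).
  have Gy0 : G y = 0 by rewrite -Uy (atom_comm L_csl _ aG LU) UG.
  exists 0; rewrite Gy0; split=> //; first exact: (alg0 A_alg).
    by apply/opboundE; rewrite nrm0 mulr0; split=> // z; rewrite mul0r.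
  by move=> z; exact: lin0.
have E1 z : (T1 + T) z = T1 z + T z by [].
exists (T1 + T); split; first exact: (alg_add A_alg).
- by rewrite E1 T1x Tx big_cons.
- move=> z; rewrite E1 (nrm_sqrD dot_norm).
  have -> : rdot (T1 z) (T z) = 0.
    by rewrite -T1G (oproj_rdot _ _ oG) Toff// rdot0r.
  rewrite mulr0 addr0 big_cons mulrDr lerD//.
  have /opboundE[_ /(_ z)] := T1b; rewrite mulrAC => h.
  rewrite -exprMn ler_pXn2r// nnegrE ?nrm_ge0//.
  exact: le_trans (nrm_ge0 _) h.
- move=> B z aB; rewrite inE negb_or => /andP[BG Bs].
  rewrite E1 (linD _ _ (aL aB)) Toff// addr0 -T1G.
  by apply: (atom_ortho dot_norm L_csl _ aG aB) => GB; rewrite GB eqxx in BG.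
Qed.

(** The orbit of a vector not killed by an atom contains all of the hull of that
   atom: a vector of the hull is approximated by finitely many of its
   components along atoms, and the errors are corrected successively. *)
Lemma hull_in_orbit E U x : atom L E -> smallest_over L (range E) U ->
  E x <> 0 -> range U `<=` orbit A x.
Proof.
move=> aE hU Ex0; have [LU _ _] := hU; have oU := L_oproj L_csl LU.
have C0 : 0 <= 8 / nrm (E x) by rewrite divr_ge0// nrm_ge0.
have lU := L_linear L_csl LU.
suff h : forall y, [set y | U y = y] y -> exists T, [/\ A T,
    opbound T (2 * (8 / nrm (E x)) * nrm y) & T x = y].
  by move=> y /(range_oproj _ oU)/h[T [AT _ Tx]]; exists T.
apply: (solve_by_halving A_alg A_closed C0) => y /= Uy.
have [->|/eqP y0] := eqVneq y 0.
  exists 0; rewrite nrm0 !subrr mulr0 mul0r (lin0 lU) nrm0.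
  split=> //; first exact: (alg0 A_alg).
  by apply/opboundE; split=> // z; rewrite nrm0 mul0r.
have y2 : 0 < nrm y / 2 by rewrite divr_gt0// nrm_gt0.
have [s [hs us sy]] := atoms_approx dot_norm L_csl L_hyperatomic y y2.
have [T [AT Tx Tb _]] := finite_sum_in_orbit aE hU Ex0 Uy hs us.
exists T; split=> //.
- apply/opboundE; split=> [|z]; first by rewrite mulr_ge0// nrm_ge0.
  rewrite -(@ler_pXn2r _ 2)// ?nnegrE ?nrm_ge0//; last first.
    by rewrite mulr_ge0 ?nrm_ge0// mulr_ge0 ?nrm_ge0.
  apply: (le_trans (Tb z)); rewrite [X in _ <= X ^+ 2]mulrAC [leRHS]exprMn.
  apply: ler_wpM2l; first exact: sqr_ge0.
  exact: (atoms_energy dot_norm L_csl y hs us).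
- rewrite (linB _ _ lU) Uy Tx; congr (_ - _).
  elim: s hs {us sy Tx Tb} => [|B s IH] hs; first by rewrite big_nil (lin0 lU).
  rewrite big_cons (linD _ _ lU) IH; last first.
    by move=> C Cs; apply: hs; rewrite inE Cs orbT.
  by rewrite -(atom_comm L_csl y (hs _ (mem_head B s)) LU) Uy.
- by rewrite Tx -off_atomsE.
Qed.

(** Each atom that does not vanish on S puts its hull inside N. Finitely many of
   these hulls have P below their join, and the range of a join in L is the
   plain sum of the ranges, so it stays inside the linear manifold N. *)
Lemma smallest_over_in_orbits S P N : submod_closed (mem N) ->
  smallest_over L S P -> (forall x, S x -> orbit A x `<=` N) ->
  range P `<=` N.
Proof.
move=> [N0 Nlin] SP SN.
have [s [sS minP]] := nonvanishing_atoms dot_norm L_csl L_hyperatomic SP.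
have [J [LJ JN sJ]] : exists J, [/\ L J, range J `<=` N &
    forall B, B \in s -> proj_le B J].
  elim: s sS {minP} => [|B s IH] sS.
    exists 0; split=> //; first exact: csl_bot L_csl.
    by move=> _ [z _ <-]; exact/set_mem.
  have [C Cs|J [LJ JN sJ]] := IH; first by apply: sS; rewrite inE Cs orbT.
  have [aB [x Sx Bx]] := sS B (mem_head _ _).
  have [U [F [hU _ _ _]]] := atom_hull dot_norm L_csl aB.
  have [LU BU _] := hU; have UN := hull_in_orbit aB hU Bx.
  have [oU oJ] := (L_oproj L_csl LU, L_oproj L_csl LJ).
  have LK := L_join dot_norm L_csl LU LJ.
  exists (proj_join U J); split=> // [_ [z _ <-]|C].
    have -> : proj_join U J z = 1 *: U z + J (z - U z).
      rewrite proj_joinE (linB _ _ (L_linear L_csl LJ)) scale1r.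
      rewrite (L_comm L_csl _ LU LJ).
      by rewrite addrA.
    apply/set_mem/Nlin; apply/mem_set.
      by apply: SN Sx _ _; apply: UN; exists z.
    by apply: JN; exists (z - U z).
  rewrite inE => /predU1P[->|/sJ CJ]; apply/(proj_leP _ (L_oproj L_csl LK)) => z.
    rewrite proj_joinE (L_comm L_csl _ LU LJ) ((proj_leP _ oU).1 BU).
    by rewrite addrK.
  by rewrite proj_joinE ((proj_leP _ oJ).1 CJ) addrAC subrr add0r.
exact: subset_trans (minP _ LJ sJ) JN.
Qed.

Lemma man_ranges M : man A M -> exists2 P, L P & range P = M.
Proof.
move=> [Mlin MA]; have [P SP] := smallest_over_exists dot_norm L_csl M.
have [LP MP _] := SP; exists P => //; apply/seteqP; split=> //.
apply: (smallest_over_in_orbits Mlin SP) => x Mx _ [T AT <-].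
by apply: MA AT _ _; exists x.
Qed.

Lemma orbit_submod x : submod_closed (mem (orbit A x)).
Proof.
split; first by apply/mem_set; exists 0 => //; exact: (alg0 A_alg).
move=> a _ _ /set_mem[S AS <-] /set_mem[T AT <-]; apply/mem_set.
by exists (a *: S + T) => //; exact: (alg_lincomb A_alg).
Qed.

Lemma orbit_range x : exists P, smallest_over L [set x] P /\ range P = orbit A x.
Proof.
have [P SP] := smallest_over_exists dot_norm L_csl [set x].
exists P; split=> //; have [LP xP _] := SP; apply/seteqP; split.
  by apply: (smallest_over_in_orbits (orbit_submod x) SP) => _ ->.
move=> _ [T /A_sub[_ TL] <-]; apply: TL LP _ _; exists x => //.
exact: xP.
Qed.

Lemma range_lat P : L P -> lat A (range P).
Proof.
move=> LP; have oP := L_oproj L_csl LP; split.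
  split=> [|T /A_sub[_ /(_ P LP)]//].
  split; first exact/mem_set/(range_oproj _ oP)/(lin0 (oproj_linear oP)).
  move=> a u v /set_mem[u' _ <-] /set_mem[v' _ <-]; apply/mem_set.
  by exists (a *: u' + v') => //; exact: (L_linear L_csl LP).
exact: closed_range_oproj.
Qed.

Lemma alg_transitive : transitive_over A (alg L).
Proof.
move=> x; apply/seteqP; split=> [_ [T AT <-]|_ [T [_ TL] <-]].
  by exists T => //; exact: A_sub.
have [P [[LP xP _] <-]] := orbit_range x.
by apply: TL LP _ _; exists x => //; exact: xP.
Qed.

(** The generator is a sum of nonzero vectors taken from finitely many distinct
   atoms whose hull is P. Its components in these atoms are nonzero, so the
   smallest projection over it contains the atoms, hence equals P. *)
Lemma range_singly_generated P : L P -> singly_generated A (range P).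
Proof.
move=> LP; have oP := L_oproj L_csl LP.
have SP : smallest_over L (range P) P by split=> // Q _.
have [s [sS minP]] := nonvanishing_atoms dot_norm L_csl L_hyperatomic SP.
have /choice[w wP] : forall G, exists v, atom L G -> G v <> 0.
  move=> G; have [/atom_neq0[v Gv]|nG] := pselect (atom L G); first by exists v.
  by exists 0.
pose t := undup s.
have tA G : G \in t -> atom L G by rewrite mem_undup => /sS[].
pose z := \sum_(G <- t) G (w G).
have Gz G : G \in t -> G z = G (w G).
  exact: (sum_atoms_in dot_norm L_csl w tA (undup_uniq s)).
exists z; have [Q [[LQ zQ minQ] <-]] := orbit_range z.
have oQ := L_oproj L_csl LQ.
have PQ : proj_le P Q.
  apply: minP => // G Gs; have aG := (sS _ Gs).1.
  have [GQ|GQ] := atom_dichotomy dot_norm L_csl aG LQ.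
    by apply/(proj_leP _ oQ).
  exfalso; have Gt : G \in t by rewrite mem_undup.
  apply: (wP G aG); rewrite -Gz//.
  have <- : Q z = z by apply/(range_oproj _ oQ); exact: zQ.
  by rewrite (atom_comm L_csl _ aG LQ) GQ.
have QP : proj_le Q P.
  apply: minQ => // _ ->; apply/(range_oproj _ oP).
  have lP := L_linear L_csl LP.
  rewrite /z big_seq; elim/big_ind: _ => [|u v Pu Pv|G]; first exact: lin0.
    by rewrite (linD _ _ lP) Pu Pv.
  rewrite mem_undup => /sS[aG [u [u' _ <-] Gu]].
  have [->//|PG] := atom_dichotomy dot_norm L_csl aG LP.
  by case: Gu; rewrite (atom_comm L_csl _ aG LP) PG.
by apply/seteqP.
Qed.

End Orbits.

Theorem theorem7 (R : realType) (H : completeNormedModType R[i])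
    (dot : {dot H for (@Num.conj R[i])})
    (dot_norm : induces_norm dot)
    (H_separable : separable_space H)
    (L : set (H -> H)) (L_csl : csl dot L) (L_hyperatomic : hyperatomic L)
    (A : set (H -> H)) (A_alg : operator_algebra A)
    (A_sub : A `<=` alg L) (A_closed : norm_closed A)
    (A_dense : wot_closure dot A = alg L)
    (A_atoms : forall E F, atom L E -> atom L F -> compression E A F `<=` A)
    (A_cstar : forall E, atom L E -> cstar_algebra dot (compression E A E)) :
  [/\ man A = lat A,
      lat A = ranges L,
      forall M, man A M -> singly_generated A M &
      transitive_over A (alg L)].
Proof.
have man_L M : man A M -> exists2 P, L P & range P = M.
  exact: (man_ranges dot_norm L_csl L_hyperatomic).
have L_lat P : L P -> lat A (range P) by exact: range_lat.
split.
- apply/seteqP; split=> [M /man_L[P /L_lat PM <-]//|M []//].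
- apply/seteqP; split=> [M [/man_L[P LP <-] _]|_ [P /L_lat PM <-]//].
  by exists P.
- move=> M /man_L[P LP <-].
  exact: (range_singly_generated dot_norm L_csl L_hyperatomic).
- exact: (alg_transitive dot_norm L_csl L_hyperatomic).
Qed.
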